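(* Let $G$ be a grid diagram with parameters $(n,p,q)$ representing a knot in $L(p,q)$, and let $\mathcal{S}$ be a sign assignment on $G$. Then $\partial_{\mathcal{S}}^2=0$ on $\mathrm{GC}^-(G;\mathbb{Z})$ and on $\widehat{\mathrm{GC}}(G;\mathbb{Z})$.
   Context: **Grid diagrams.** Let $n\ge 1$ and let $p\ge 1$, $q$ be coprime integers with $0<q<p$, or $(p,q)=(1,0)$. Let $T=\mathbb{R}^2/\Lambda$, where $\Lambda$ is the lattice generated by $(pn,0)$ and $(qn,n)$ (equivalently, the rectangle $[0,pn]\times[0,n]$ with left and right sides identified, and $(s,n)\sim(s-qn \bmod pn,0)$). For $1\le l,j\le n$, $\alpha_l\subset T$ is the circle that is the image of the line $\{y=l-1\}$, and $\beta_j\subset T$ is the circle that is the image of the lines $\{x=c\}$, $c\in\mathbb{Z}$, $c\equiv j-1 \pmod n$. Each $\alpha_l$ meets each $\beta_j$ in $p$ points. The row (column) regions are the annuli between consecutive $\alpha$ (resp. $\beta$) circles. A grid diagram $G$ with parameters $(n,p,q)$ is this data with two sets of markings $\mathbb{X}=\{\mathbb{X}_1,\dots,\mathbb{X}_n\}$, $\mathbb{O}=\{\mathbb{O}_1,\dots,\mathbb{O}_n\}$, placed at centres of unit squares of $T\setminus(\alpha\cup\beta)$, such that each row and each column contains exactly one $\mathbb{X}$ and one $\mathbb{O}$, and each square contains at most one marking. Joining each $\mathbb{X}$ to the $\mathbb{O}$ in its row, and each $\mathbb{O}$ to the $\mathbb{X}$ in its column (vertical arcs over horizontal ones), gives a link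 in the lens space $L(p,q)$; $G$ represents a knot if this link has a single component. **Generators.** $S(G)$ is the set of $n$-tuples of points of $\alpha\cap\beta$ with exactly one point on each $\alpha_l$ and one on each $\beta_j$. **Rectangles.** For $x,y\in S(G)$, $\mathrm{Rect}(x,y)$ is the set of rectangles $r=[a,a+w]\times[b,b+h]\subset\mathbb{R}^2$ with $a,b\in\mathbb{Z}$ and integers $0<w,h<pn$, up to translation by $\Lambda$ (viewed as immersed rectangles in $T$), such that the lower left and upper right corners project to two distinct points of $x$, the lower right and upper left corners project to two distinct points of $y$, and $x$ and $y$ agree in all other points. $\mathrm{Rect}(G)=\bigcup_{x,y}\mathrm{Rect}(x,y)$. $r\in \mathrm{Rect}(x,y)$ is empty, $r\in\mathrm{Rect}^\circ(x,y)$, if no interior point of $r$ projects to a point of $x$. $O_i(r)$ is the number of points of $r$ projecting to $\mathbb{O}_i$, and $r\cap\mathbb{X}=\emptyset$ means no point of $r$ projects to an $\mathbb{X}$ marking. **Concatenation.** For $r_1\in \mathrm{Rect}(x,y)$, $r_2\in \mathrm{Rect}(y,z)$, the concatenation $r_1*r_2$ is the polygon from $x$ to $z$, immersed in $T$, obtained by gluing $r_1$ and $r_2$ along the overlapping portions of the edges emanating from each point of $y$ that is a corner of both (it is the formal union of $r_1$ and $r_2$ if they share no such corner). $r_1*r_2=r_3*r_4$ means that the two pairs are decompositions of the same immersed polygon from $x$ to $z$. $r_1*r_2$ is a horizontal annulus if $r_1,r_2$ have lifts $[a,a+w]\times[b,b+h]$ and $[a+w,a+pn]\times[b,b+h]$,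 and a vertical annulus if they have lifts $[a,a+w]\times[b,b+h]$ and $[a,a+w]\times[b+h,b+pn]$. **Sign assignments.** A sign assignment on $G$ is a function $\mathcal{S}:\mathrm{Rect}(G)\to\{\pm1\}$ such that: (1) if $r_1*r_2=r_3*r_4$ with $(r_1,r_2)\ne(r_3,r_4)$, then $\mathcal{S}(r_1)\mathcal{S}(r_2)=-\mathcal{S}(r_3)\mathcal{S}(r_4)$; (2) if $r_1*r_2$ is a horizontal annulus, then $\mathcal{S}(r_1)\mathcal{S}(r_2)=1$; (3) if $r_1*r_2$ is a vertical annulus, then $\mathcal{S}(r_1)\mathcal{S}(r_2)=-1$. **Sign refined complexes.** $\mathrm{GC}^-(G;\mathbb{Z})$ is the free $\mathbb{Z}[V_1,\dots,V_n]$-module on $S(G)$, and $\widehat{\mathrm{GC}}(G;\mathbb{Z})$ is the free module on $S(G)$ over $\mathbb{Z}[V_1,\dots,V_n]/(V_1)$. On both, $\partial_{\mathcal{S}}$ is the linear endomorphism with $$\partial_{\mathcal{S}}(x)=\sum_{y\in S(G)}\ \sum_{r\in\mathrm{Rect}^\circ(x,y),\ r\cap\mathbb{X}=\emptyset}\mathcal{S}(r)\Big(\prod_{i=1}^nV_i^{O_i(r)}\Big)y.$$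
   Formalization: A rectangle from x to y is called empty here only if its interior contains no point projecting to x or to y; with the condition on x alone, the claim fails for some self-overlapping immersed rectangles, for example with (n,p,q)=(3,3,2). *)

(* Defs.v *)
From HB Require Import structures.
From mathcomp Require Import all_boot all_order all_algebra.
From mathcomp Require Import generic_quotient ring_quotient.
From mathcomp Require Import boolp.
From mathcomp Require Import mpoly.
From mathcomp Require Import ring.

Set Implicit Arguments.
Unset Strict Implicit.
Unset Printing Implicit Defensive.

Import GRing.Theory Num.Theory.
Local Open Scope ring_scope.

Record grid_params := GridParams {
  gn : nat;
  gp : nat;
  gq : nat;
  gn_gt0 : (0 < gn)%N;
  gp_gt0 : (0 < gp)%N;
  gpqP : (coprime gp gq && (0 < gq < gp)%N) || ((gp == 1%N) && (gq == 0%N)) }.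

Lemma residue_subproof (m : nat) (m_gt0 : (0 < m)%N) (a : int) :
  (`|(a %% m)%Z| < m)%N.
Proof.
have m0 : m%:Z != 0 by rewrite eqz_nat -lt0n.
by rewrite -ltz_nat gez0_abs ?modz_ge0 // ltz_pmod // ltz_nat.
Qed.

Definition residue (m : nat) (m_gt0 : (0 < m)%N) (a : int) : 'I_m :=
  Ordinal (residue_subproof m_gt0 a).

Lemma residueE (m : nat) (m_gt0 : (0 < m)%N) (a : int) :
  (residue m_gt0 a)%:Z = (a %% m)%Z.
Proof. by rewrite /= gez0_abs // modz_ge0 // eqz_nat -lt0n. Qed.

Lemma residue_eq (m : nat) (m_gt0 : (0 < m)%N) (a b : int) :
  residue m_gt0 a = residue m_gt0 b <-> exists k : int, b - a = m%:Z * k.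
Proof.
split=> [/(congr1 (fun i : 'I_m => i%:Z))|[k e]].
  rewrite !residueE => /eqP; rewrite eq_sym eqz_mod_dvd => /dvdzP[k ->].
  by exists k; rewrite mulrC.
apply/val_inj/eqP; rewrite -eqz_nat !residueE eq_sym eqz_mod_dvd e.
exact: dvdz_mulr.
Qed.

Section Grid.
Variable P : grid_params.
Local Notation n := (gn P).
Local Notation p := (gp P).
Local Notation q := (gq P).

Lemma circ_gt0 : (0 < p * n)%N.
Proof. by rewrite muln_gt0 gn_gt0 gp_gt0. Qed.

(* The integer points of T = R^2 / Lambda, which are exactly the points of the
   alpha circles on the beta circles.  The class of (s, t) is stored through
   its representative in [0, pn) x [0, n).  A unit square of T is stored as its
   lower left corner. *)
Definition torus : Type := ('I_(p * n) * 'I_n)%type.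

Definition proj (a b : int) : torus :=
  (residue circ_gt0 (a - (q * n)%:Z * (b %/ n)%Z), residue (gn_gt0 P) b).

Lemma proj_eq (a b a' b' : int) :
  proj a b = proj a' b' <->
  exists k m : int, a' - a = (p * n)%:Z * k + (q * n)%:Z * m /\
                    b' - b = n%:Z * m.
Proof.
have n0 : n%:Z != 0 by rewrite eqz_nat -lt0n gn_gt0.
split=> [[ea eb]|[k [m [ea eb]]]].
  have /residue_eq[m em] : residue (gn_gt0 P) b = residue (gn_gt0 P) b'.
    exact: val_inj.
  have /residue_eq[k ek] : residue circ_gt0 (a - (q * n)%:Z * (b %/ n)%Z) =
      residue circ_gt0 (a' - (q * n)%:Z * (b' %/ n)%Z).
    exact: val_inj.
  exists k, m; split => //.
  have eb' : (b' %/ n)%Z = (b %/ n)%Z + m.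
    by rewrite -(subrK b b') em mulrC divzMDl // addrC.
  by rewrite -ek eb' mulrDr; ring.
have eb' : (b' %/ n)%Z = (b %/ n)%Z + m.
  by rewrite -(subrK b b') eb mulrC divzMDl // addrC.
congr pair; last by apply/residue_eq; exists m.
apply/residue_eq; exists k; rewrite eb' mulrDr -[a'](subrK a) ea; ring.
Qed.

Definition translate (A : torus) (u v : nat) : torus :=
  proj (A.1%:Z + u%:Z) (A.2%:Z + v%:Z).

(* Row l lies just above alpha_(l+1), column j just to the right of
   beta_(j+1); a point has the row and column of the square above and to the
   right of it, i.e. lies on alpha_(row + 1) and beta_(column + 1). *)
Definition row_of (A : torus) : 'I_n := A.2.
Definition col_of (A : torus) : 'I_n := residue (gn_gt0 P) A.1%:Z.

Record grid_diagram := GridDiagram {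
  markX : 'I_n -> torus;
  markO : 'I_n -> torus;
  markX_row : forall l, exists! i, row_of (markX i) = l;
  markX_col : forall j, exists! i, col_of (markX i) = j;
  markO_row : forall l, exists! i, row_of (markO i) = l;
  markO_col : forall j, exists! i, col_of (markO i) = j;
  markXO : forall i j, markX i <> markO j }.

(* The arcs of the link: inl i stands for X_i and inr i for O_i.  At a crossing
   the two arcs do not meet in the lens space, so the components of the link
   are those of this graph. *)
Definition link_arc (G : grid_diagram) : rel ('I_n + 'I_n) :=
  fun u v => match u, v with
  | inl i, inr j | inr j, inl i =>
      (row_of (markX G i) == row_of (markO G j)) ||
      (col_of (markX G i) == col_of (markO G j))
  | _, _ => false
  end.

Definition represents_knot (G : grid_diagram) : Prop :=
  n_comp (link_arc G) predT = 1%N.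

Definition is_generator (x : {set torus}) : bool :=
  [forall l, #|[set A in x | row_of A == l]| == 1%N] &&
  [forall j, #|[set A in x | col_of A == j]| == 1%N].

Definition generator : Type := {x : {set torus} | is_generator x}.

(* A rectangle modulo Lambda: the class of its lower left corner, its width and
   its height. *)
Definition rectangle : Type := (torus * 'I_(p * n) * 'I_(p * n))%type.
Definition width (r : rectangle) : nat := r.1.2.
Definition height (r : rectangle) : nat := r.2.
Definition llc (r : rectangle) : torus := r.1.1.
Definition lrc (r : rectangle) : torus := translate (llc r) (width r) 0.
Definition ulc (r : rectangle) : torus := translate (llc r) 0 (height r).
Definition urc (r : rectangle) : torus :=
  translate (llc r) (width r) (height r).

Definition connects (x y : {set torus}) (r : rectangle) : bool :=
  [&& (0 < width r)%N, (0 < height r)%N,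
      [&& llc r \in x, urc r \in x & llc r != urc r],
      [&& lrc r \in y, ulc r \in y & lrc r != ulc r] &
      x :\: [set llc r; urc r] == y :\: [set lrc r; ulc r]].

(* Rect(G) is the disjoint union of the sets Rect(x, y): the same rectangle may
   connect several pairs of generators, and its sign depends on the pair. *)
Definition Rect : Type :=
  {u : generator * generator * rectangle |
    connects (val u.1.1) (val u.1.2) u.2}.
Definition src (r : Rect) : generator := (val r).1.1.
Definition tgt (r : Rect) : generator := (val r).1.2.
Definition shape (r : Rect) : rectangle := (val r).2.

Definition interior_misses (r : rectangle) (x : {set torus}) : bool :=
  [forall i : 'I_(width r), forall j : 'I_(height r),
    ((0 < i)%N && (0 < j)%N) ==> (translate (llc r) i j \notin x)].

(* For a rectangle whose interior embeds in T the condition on tgt r follows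
   from the one on src r.  For a rectangle that overlaps itself it does not: the
   lower right or upper left corner, a point of tgt r, can lie in the interior.
   Such rectangles have to be excluded for the differential to square to 0. *)
Definition empty_rect (r : Rect) : bool :=
  interior_misses (shape r) (val (src r)) &&
  interior_misses (shape r) (val (tgt r)).

(* The unit squares of a lift of r; cell (i, j) has the lower left corner of r
   translated by (i, j) as its own lower left corner. *)
Definition cell (r : rectangle) : Type := ('I_(width r) * 'I_(height r))%type.
Definition cell_pos (r : rectangle) (c : cell r) : torus :=
  translate (llc r) c.1 c.2.

Definition avoidsX (G : grid_diagram) (r : Rect) : bool :=
  [forall c : cell (shape r), forall i, cell_pos c != markX G i].

Definition countO (G : grid_diagram) (r : Rect) (i : 'I_n) : nat :=
  #|[set c : cell (shape r) | cell_pos c == markO G i]|.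

(* An immersed polygon is a surface tiled by unit squares together with its map
   to T: tile_right c d means that the right edge of c is glued to the left
   edge of d, and tile_up c d that the top edge of c is glued to the bottom
   edge of d. *)
Record polygon := Polygon {
  tile : finType;
  tile_pos : tile -> torus;
  tile_right : rel tile;
  tile_up : rel tile }.

(* Equality of immersed polygons: reparametrisation over T. *)
Definition same_polygon (A B : polygon) : Prop :=
  exists f : tile A -> tile B,
    [/\ bijective f,
        forall c, tile_pos (f c) = tile_pos c,
        forall c d, tile_right (f c) (f d) = tile_right c d &
        forall c d, tile_up (f c) (f d) = tile_up c d].

Section Concatenation.
Variables r1 r2 : rectangle.

Definition concat_pos (c : cell r1 + cell r2) : torus :=
  match c with inl c => cell_pos c | inr c => cell_pos c end.

(* The corners of r1 at the intermediate generator are lrc r1 and ulc r1, those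
   of r2 are llc r2 and urc r2.  When two of them coincide, exactly one pair of
   edges emanating from the common corner overlaps:
     lrc r1 = llc r2   right edge of r1, left edge of r2, from their bottoms;
     ulc r1 = urc r2   left edge of r1, right edge of r2, from their tops;
     ulc r1 = llc r2   top edge of r1, bottom edge of r2, from their left ends;
     lrc r1 = urc r2   bottom edge of r1, top edge of r2, from their right ends.
   In each case the glued portion is as long as the shorter of the two edges.
   Both corners may be common, and the result is then an annulus. *)
Definition concat_right : rel (cell r1 + cell r2) :=
  fun c d => match c, d with
  | inl c, inl d => (c.1.+1 == d.1 :> nat) && (c.2 == d.2 :> nat)
  | inr c, inr d => (c.1.+1 == d.1 :> nat) && (c.2 == d.2 :> nat)
  | inl c, inr d =>
      [&& lrc r1 == llc r2, c.1.+1 == width r1, d.1 == 0%N :> nat &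
          c.2 == d.2 :> nat]
  | inr c, inl d =>
      [&& ulc r1 == urc r2, c.1.+1 == width r2, d.1 == 0%N :> nat &
          (height r2 - c.2 == height r1 - d.2)%N]
  end.

Definition concat_up : rel (cell r1 + cell r2) :=
  fun c d => match c, d with
  | inl c, inl d => (c.1 == d.1 :> nat) && (c.2.+1 == d.2 :> nat)
  | inr c, inr d => (c.1 == d.1 :> nat) && (c.2.+1 == d.2 :> nat)
  | inl c, inr d =>
      [&& ulc r1 == llc r2, c.2.+1 == height r1, d.2 == 0%N :> nat &
          c.1 == d.1 :> nat]
  | inr c, inl d =>
      [&& lrc r1 == urc r2, c.2.+1 == height r2, d.2 == 0%N :> nat &
          (width r2 - c.1 == width r1 - d.1)%N]
  end.

Definition concat : polygon := Polygon concat_pos concat_right concat_up.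

End Concatenation.

Definition composable (r1 r2 : Rect) : Prop := tgt r1 = src r2.

Definition same_concat (r1 r2 r3 r4 : Rect) : Prop :=
  [/\ src r1 = src r3, tgt r2 = tgt r4 &
      same_polygon (concat (shape r1) (shape r2))
                   (concat (shape r3) (shape r4))].

Definition horizontal_annulus (r1 r2 : rectangle) : Prop :=
  [/\ llc r2 = lrc r1, height r2 = height r1 &
      (width r1 + width r2 = p * n)%N].

Definition vertical_annulus (r1 r2 : rectangle) : Prop :=
  [/\ llc r2 = ulc r1, width r2 = width r1 &
      (height r1 + height r2 = p * n)%N].

Record sign_assignment (S : Rect -> int) : Prop := SignAssignment {
  sign_values : forall r, S r = 1 \/ S r = -1;
  sign_square : forall r1 r2 r3 r4 : Rect,
    composable r1 r2 -> composable r3 r4 ->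
    same_concat r1 r2 r3 r4 -> (r1, r2) <> (r3, r4) ->
    S r1 * S r2 = - (S r3 * S r4);
  sign_horizontal : forall r1 r2 : Rect, composable r1 r2 ->
    horizontal_annulus (shape r1) (shape r2) -> S r1 * S r2 = 1;
  sign_vertical : forall r1 r2 : Rect, composable r1 r2 ->
    vertical_annulus (shape r1) (shape r2) -> S r1 * S r2 = -1 }.

Section Complex.
Variables (R : comNzRingType) (V : 'I_n -> R).
Variables (G : grid_diagram) (S : Rect -> int).

(* The free R-module on the generators. *)
Definition chain : Type := {ffun generator -> R^o}.

Definition basis (x : generator) : chain := [ffun z => (z == x)%:R].

Definition diff_gen (x : generator) : chain :=
  \sum_(y : generator)
   \sum_(r : Rect | [&& src r == x, tgt r == y, empty_rect r & avoidsX G r])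
     (((S r)%:~R * \prod_(i < n) V i ^+ countO G r i) *: basis y).

Definition differential (c : chain) : chain := \sum_x c x *: diff_gen x.

Lemma differential_basis (x : generator) : differential (basis x) = diff_gen x.
Proof.
rewrite /differential (bigD1 x) //= ffunE eqxx scale1r big1 ?addr0 // => y yx.
by rewrite ffunE (negPf yx) scale0r.
Qed.

Lemma differential_linear : linear differential.
Proof.
move=> a c d; rewrite /differential scaler_sumr -big_split /=.
by apply: eq_bigr => x _; rewrite !ffunE scalerDl scalerA.
Qed.

End Complex.

Definition poly_ring : comNzRingType := {mpoly int[n]}.

Definition V_minus (i : 'I_n) : poly_ring := 'X_i.

Definition first_index : 'I_n := Ordinal (gn_gt0 P).

Definition V1_ideal (f : poly_ring) : bool :=
  `[< exists g, f = V_minus first_index * g >].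

Lemma V1_ideal_closed : idealr_closed V1_ideal.
Proof.
split=> [||a u v /asboolP[g ->] /asboolP[h ->]].
- by apply/asboolP; exists 0; rewrite mulr0.
- apply/asboolP => -[g /(congr1 (meval (fun=> 0 : int)))].
  by rewrite mevalM mevalXU mul0r meval1 => /eqP; rewrite oner_eq0.
- by apply/asboolP; exists (a * g + h); rewrite mulrDr mulrCA.
Qed.

HB.instance Definition _ := isIdealr.Build poly_ring V1_ideal V1_ideal_closed.

Definition V1_idealr : idealr poly_ring := V1_ideal.

Definition hat_ring : comNzRingType := {ideal_quot V1_idealr}.

Definition V_hat (i : 'I_n) : hat_ring :=
  \pi_({ideal_quot V1_idealr})%qT (V_minus i).

Definition GCminus : Type := chain poly_ring.
Definition GChat : Type := chain hat_ring.

Definition diff_minus (G : grid_diagram) (S : Rect -> int) (c : GCminus) :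
  GCminus := differential V_minus G S c.
Definition diff_hat (G : grid_diagram) (S : Rect -> int) (c : GChat) :
  GChat := differential V_hat G S c.

End Grid.

(* Main.v *)
(** The coefficient of z in the square of the differential at x is a sum over
pairs (r1, r2) of empty rectangles from x to y and from y to z that avoid the
X markings.  Every such pair has a partner: a different pair of empty
rectangles forming the same immersed polygon, which therefore has the same
weight and the opposite sign.  A third decomposition of the polygon would have
pairwise opposite signs with the first two, so partners form an involution and
the sum vanishes.

To find the partner, lift to the plane.  If r1 and r2 share no corner, swap
them.  If they share one corner, their lifts form an L, which can be cut in the
other direction at its reflex corner.  If they share both corners, the polygon
is either an annulus, which contains an X, or a spiral: the quotient of an
infinite staircase strip by a translation, where cutting in the other direction
at the reflex corners gives the partner.  Transposition, and reflection combined
with reversal of the order, reduce all positions of the shared corners to one.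

That the partner is again empty is seen by counting.  Let n_x(r) be the sum
of the multiplicities of r at the points of x, averaged over the four quadrants
at each point.  Since n_(y - z)(r1) = n_(x - y)(r2), the sum
n_x(r1) + n_y(r1) + n_y(r2) + n_z(r2) equals the value of n_x + n_z on the
polygon, and it attains its minimum 2 exactly when both rectangles are empty;
the bound pn on the sizes of the rectangles comes out in the same way. *)

From mathcomp Require Import all_boot all_order all_algebra.
From mathcomp Require Import boolp zify ring.
Require Import Defs.
Set Implicit Arguments.
Unset Strict Implicit.
Unset Printing Implicit Defensive.
Import Order.TTheory GRing.Theory Num.Theory.
Local Open Scope ring_scope.

(** * Rectangles in the plane *)

Record rect := MkRect { x0 : int; y0 : int; x1 : int; y1 : int }.

Definition nonempty R := (x0 R < x1 R) && (y0 R < y1 R).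
(** The bounds are half-open because [(i, j)] stands for the unit square of which it is the lower
    left corner. *)
Definition in_rect R (i j : int) := (x0 R <= i < x1 R) && (y0 R <= j < y1 R).

Section Plane.
Variables (T : finType) (N : int).
Implicit Types (pi : int -> int -> T) (x y z : {set T}) (R S : rect).

(** What the planar argument uses of the projection to [T]: coincidences are invariant under common
    shifts, and horizontal and vertical lines both close up after exactly [N] steps. The conditions
    are symmetric in the two directions, so transposition and reflection preserve them. *)
Record plane_cover pi : Prop := PlaneCover {
  cover_shift : forall a b a' b' u v,
    pi a b = pi a' b' -> pi (a + u) (b + v) = pi (a' + u) (b' + v);
  cover_row : forall a b u, pi (a + u) b = pi a b <-> (N %| u)%Z;
  cover_col : forall a b v, pi a (b + v) = pi a b <-> (N %| v)%Z }.

Definition one_per_line pi x : Prop :=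
  (forall a a' b, pi a b \in x -> pi a' b \in x -> pi a b = pi a' b) /\
  (forall a b b', pi a b \in x -> pi a b' \in x -> pi a b = pi a b').

Definition ll pi R := pi (x0 R) (y0 R).
Definition lr pi R := pi (x1 R) (y0 R).
Definition ul pi R := pi (x0 R) (y1 R).
Definition ur pi R := pi (x1 R) (y1 R).

(** The formal difference of the points in which a rectangle changes its source generator into its
    target. In this additive form, consecutive moves compose by adding, with intermediate points
    cancelling. *)
Definition corners pi R (t : T) : int :=
  (t == ll pi R)%:Z + (t == ur pi R)%:Z - (t == lr pi R)%:Z - (t == ul pi R)%:Z.

Record moves pi x y R : Prop := Moves {
  moves_eq : forall t, (t \in x)%:Z - (t \in y)%:Z = corners pi R t;
  moves_ll : ll pi R \in x;
  moves_ur : ur pi R \in x;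
  moves_src : ll pi R <> ur pi R;
  moves_lr : lr pi R \in y;
  moves_ul : ul pi R \in y;
  moves_tgt : lr pi R <> ul pi R }.

Definition small R := (x1 R - x0 R < N) && (y1 R - y0 R < N).

Definition sim pi R R' :=
  [/\ ll pi R = ll pi R', x1 R - x0 R = x1 R' - x0 R' &
      y1 R - y0 R = y1 R' - y0 R'].

(* The polygon is a region of the plane modulo M, a trivial or cyclic group of
   translations in the lattice. *)
Record deck_group pi (M : int -> int -> Prop) : Prop := DeckGroup {
  deck0 : M 0 0;
  deckD : forall a b c d, M a b -> M c d -> M (a + c) (b + d);
  deckN : forall a b, M a b -> M (- a) (- b);
  deck_cover : forall a b i j, M a b -> pi (i + a) (j + b) = pi i j }.

(* The unit squares of the rectangle are pairwise incongruent modulo M, and no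
   two of them become neighbours modulo M that were not neighbours before. *)
Definition develops1 (M : int -> int -> Prop) R :=
  forall i j k l, in_rect R i j -> in_rect R k l ->
  [/\ M (k - i) (l - j) -> k = i /\ l = j,
      M (k - i - 1) (l - j) -> k = i + 1 /\ l = j &
      M (k - i) (l - j - 1) -> k = i /\ l = j + 1].

(* The gluing of R and S at the corners they share is the adjacency of unit
   squares of the plane modulo M. *)
Record develops pi (M : int -> int -> Prop) R S : Prop := Develops {
  dev_fst : develops1 M R;
  dev_snd : develops1 M S;
  dev_disj : forall i j k l, in_rect R i j -> in_rect S k l ->
    ~ M (k - i) (l - j);
  dev_right12 : forall i j k l, in_rect R i j -> in_rect S k l ->
    M (k - i - 1) (l - j) <->
    [/\ lr pi R = ll pi S, i + 1 = x1 R, k = x0 S & j - y0 R = l - y0 S];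
  dev_right21 : forall i j k l, in_rect S i j -> in_rect R k l ->
    M (k - i - 1) (l - j) <->
    [/\ ul pi R = ur pi S, i + 1 = x1 S, k = x0 R & y1 S - j = y1 R - l];
  dev_up12 : forall i j k l, in_rect R i j -> in_rect S k l ->
    M (k - i) (l - j - 1) <->
    [/\ ul pi R = ll pi S, j + 1 = y1 R, l = y0 S & i - x0 R = k - x0 S];
  dev_up21 : forall i j k l, in_rect S i j -> in_rect R k l ->
    M (k - i) (l - j - 1) <->
    [/\ lr pi R = ur pi S, j + 1 = y1 S, l = y0 R & x1 S - i = x1 R - k] }.

Definition covers (M : int -> int -> Prop) R S R' S' :=
  forall i j, in_rect R i j || in_rect S i j ->
  exists k l, (in_rect R' k l || in_rect S' k l) /\ M (k - i) (l - j).

(** The lifts [Rl], [Sl] and the group [M] are existential, since the suitable lift of the given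
    pair depends on the corners it shares. Sizes and emptiness of the new rectangles are left to the
    counting of quadrants. *)
Definition redecomposes pi x z R S R' S' :=
  [/\ nonempty R', nonempty S', ~ (sim pi R R' /\ sim pi S S'),
      exists2 w, moves pi x w R' & moves pi w z S' &
      exists Rl Sl M,
        [/\ sim pi R Rl /\ sim pi S Sl, deck_group pi M,
            develops pi M Rl Sl, develops pi M R' S' &
            covers M Rl Sl R' S' /\ covers M R' S' Rl Sl]].

(** * Symmetries: transposition and reflection *)

Definition transp R := MkRect (y0 R) (x0 R) (y1 R) (x1 R).
Definition mirror R := MkRect (- x1 R) (y0 R) (- x0 R) (y1 R).
Definition transp_pi pi : int -> int -> T := fun i j => pi j i.
Definition mirror_pi pi : int -> int -> T := fun i j => pi (- i) j.
Definition transp_deck (M : int -> int -> Prop) i j := M j i.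
Definition mirror_deck (M : int -> int -> Prop) i j := M (- i) j.

Lemma transpK R : transp (transp R) = R. Proof. by case: R. Qed.
Lemma mirrorK R : mirror (mirror R) = R.
Proof. by case: R => a b c d; rewrite /mirror /= !opprK. Qed.

Lemma mirror_piK pi : mirror_pi (mirror_pi pi) = pi.
Proof. by apply/funext => i; apply/funext => j; rewrite /mirror_pi opprK. Qed.

Lemma plane_cover_transp pi : plane_cover pi -> plane_cover (transp_pi pi).
Proof.
case=> s r c; split; rewrite /transp_pi.
- by move=> a b a' b' u v /s; apply.
- by move=> a b u; apply: c.
- by move=> a b u; apply: r.
Qed.

Lemma plane_cover_mirror pi : plane_cover pi -> plane_cover (mirror_pi pi).
Proof.
case=> s r c; split; rewrite /mirror_pi.
- by move=> a b a' b' u v e; rewrite !opprD; apply: s.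
- by move=> a b u; rewrite opprD r dvdzE abszN -dvdzE.
- by move=> a b u; apply: c.
Qed.

Lemma one_per_line_transp pi x :
  one_per_line pi x -> one_per_line (transp_pi pi) x.
Proof.
case=> h k; split; rewrite /transp_pi.
  by move=> a a' b; apply: k.
by move=> a b b'; apply: h.
Qed.

Lemma one_per_line_mirror pi x :
  one_per_line pi x -> one_per_line (mirror_pi pi) x.
Proof.
case=> h k; split; rewrite /mirror_pi.
  by move=> a a' b; apply: h.
by move=> a b b'; apply: k.
Qed.

Lemma moves_transp pi x y R :
  moves pi x y R -> moves (transp_pi pi) x y (transp R).
Proof.
case=> e a b c d f g; split; rewrite /ll /ur /lr /ul /transp_pi //=.
  move=> t; rewrite e /corners /ll /ur /lr /ul /=; ring.
by move=> h; apply: g.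
Qed.

Lemma corners_mirror pi R t :
  corners (mirror_pi pi) (mirror R) t = - corners pi R t.
Proof. by rewrite /corners /ll /ur /lr /ul /mirror_pi /= !opprK; ring. Qed.

(** Reflection exchanges lower left with lower right and upper left with upper right corners, hence
    source with target. A pair of moves therefore reverses its order. *)
Lemma moves_mirror pi x y R :
  moves pi x y R -> moves (mirror_pi pi) y x (mirror R).
Proof.
case=> e a b c d f g; split.
  by move=> t; rewrite corners_mirror -e; ring.
all: by rewrite /ll /ur /lr /ul /mirror_pi /= ?opprK.
Qed.

Lemma sim_transp pi R R' :
  sim pi R R' -> sim (transp_pi pi) (transp R) (transp R').
Proof. by case=> a b c; split. Qed.

Lemma sim_mirror pi R R' : plane_cover pi ->
  sim pi R R' -> sim (mirror_pi pi) (mirror R) (mirror R').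
Proof.
move=> hp; case: R R' => [a b c d] [a' b' c' d'] [/=]; rewrite /ll /= => e f g.
split => /=; rewrite /ll /mirror_pi /= ?opprK //; last lia.
have := cover_shift hp (c - a) 0 e.
by rewrite !addr0 {2}f !(addrC _ (_ - _)) !subrK.
Qed.

Lemma nonempty_transp R : nonempty (transp R) = nonempty R.
Proof. by rewrite /nonempty andbC. Qed.

Lemma nonempty_mirror R : nonempty (mirror R) = nonempty R.
Proof. by rewrite /nonempty /= ltrN2. Qed.

Lemma in_transp R i j : in_rect (transp R) i j = in_rect R j i.
Proof. by rewrite /in_rect andbC. Qed.

(** The unit interval from [i] to [i + 1] is reflected to the one starting at [- i - 1]. *)
Lemma in_mirror R i j : in_rect (mirror R) i j = in_rect R (- i - 1) j.
Proof. by rewrite /in_rect /=; lia. Qed.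

Lemma deck_transp pi M : deck_group pi M ->
  deck_group (transp_pi pi) (transp_deck M).
Proof.
case=> a b c d; split; rewrite /transp_pi /transp_deck //.
- by move=> *; apply: b.
- by move=> *; apply: c.
- by move=> *; apply: d.
Qed.

Lemma deck_mirror pi M : deck_group pi M ->
  deck_group (mirror_pi pi) (mirror_deck M).
Proof.
case=> a b c d; split; rewrite /mirror_pi /mirror_deck ?oppr0 //.
- by move=> *; rewrite opprD; apply: b.
- by move=> *; apply: c.
- by move=> *; rewrite opprD; apply: d.
Qed.

Lemma develops1_transp M R :
  develops1 M R -> develops1 (transp_deck M) (transp R).
Proof.
move=> h i j k l; rewrite !in_transp => hi hk.
by have [a b c] := h _ _ _ _ hi hk; split=> [/a|/c|/b] [].
Qed.

Lemma develops1_mirror pi M R : deck_group pi M ->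
  develops1 M R -> develops1 (mirror_deck M) (mirror R).
Proof.
move=> hM h i j k l; rewrite !in_mirror => hi hk; rewrite /mirror_deck.
have [a b c] := h _ _ _ _ hi hk; have [a' b' c'] := h _ _ _ _ hk hi.
split=> m.
- by have [] := a _; [congr M: m; lia | lia].
- have [] := b' _; last by lia.
  rewrite -[X in M X]opprK -[X in M _ X]opprK.
  by apply: deckN hM _ _ _; congr M: m; lia.
- by have [] := c _; [congr M: m; lia | lia].
Qed.

Lemma develops_transp pi M R S : develops pi M R S ->
  develops (transp_pi pi) (transp_deck M) (transp R) (transp S).
Proof.
case=> f s d r12 r21 u12 u21; split; try exact: develops1_transp.
all: move=> i j k l; rewrite !in_transp => hi hk; rewrite /transp_deck.
- exact: d.
- exact: u12.
- by apply: (iff_trans (u21 _ _ _ _ hi hk)).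
- exact: r12.
- by apply: (iff_trans (r21 _ _ _ _ hi hk)).
Qed.

(** Reflection reverses left and right, and the order of the two rectangles is reversed too, so
    horizontal adjacencies keep their type. Vertical adjacencies keep their direction, so there the
    two types are exchanged. *)
Lemma develops_mirror pi M R S : deck_group pi M -> develops pi M R S ->
  develops (mirror_pi pi) (mirror_deck M) (mirror S) (mirror R).
Proof.
move=> hM [f s d r12 r21 u12 u21].
split; try exact: (develops1_mirror hM).
all: move=> i j k l; rewrite !in_mirror => hi hk; rewrite /mirror_deck.
all: rewrite /ll /lr /ul /ur /mirror_pi /= ?opprK.
- move=> m; apply: (d _ _ _ _ hk hi).
  by have := deckN hM m; congr M; lia.
- have [p q] := r12 _ _ _ _ hk hi; split=> [m|[e1 e2 e3 e4]].
    have /p[e1 e2 e3 e4] : M (- i - 1 - (- k - 1) - 1) (j - l).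
      by have := deckN hM m; congr M; lia.
    by split; [exact: esym e1 | lia..].
  have /(deckN hM) : M (- i - 1 - (- k - 1) - 1) (j - l).
    by apply: q; split; [exact: esym e1 | lia..].
  by congr M; lia.
- have [p q] := r21 _ _ _ _ hk hi; split=> [m|[e1 e2 e3 e4]].
    have /p[e1 e2 e3 e4] : M (- i - 1 - (- k - 1) - 1) (j - l).
      by have := deckN hM m; congr M; lia.
    by split; [exact: esym e1 | lia..].
  have /(deckN hM) : M (- i - 1 - (- k - 1) - 1) (j - l).
    by apply: q; split; [exact: esym e1 | lia..].
  by congr M; lia.
- have [p q] := u21 _ _ _ _ hi hk; split=> [m|[e1 e2 e3 e4]].
    have /p[e1 e2 e3 e4] : M (- k - 1 - (- i - 1)) (l - j - 1).
      by have := m; congr M; lia.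
    by split; [exact: esym e1 | lia..].
  have : M (- k - 1 - (- i - 1)) (l - j - 1) by apply: q; split; [exact: esym e1 | lia..].
  by congr M; lia.
- have [p q] := u12 _ _ _ _ hi hk; split=> [m|[e1 e2 e3 e4]].
    have /p[e1 e2 e3 e4] : M (- k - 1 - (- i - 1)) (l - j - 1).
      by have := m; congr M; lia.
    by split; [exact: esym e1 | lia..].
  have : M (- k - 1 - (- i - 1)) (l - j - 1) by apply: q; split; [exact: esym e1 | lia..].
  by congr M; lia.
Qed.

Lemma covers_transp M R S R' S' : covers M R S R' S' ->
  covers (transp_deck M) (transp R) (transp S) (transp R') (transp S').
Proof.
move=> h i j; rewrite !in_transp => /h[l [k [hk m]]].
by exists k, l; rewrite !in_transp.
Qed.

Lemma covers_mirror M R S R' S' : covers M R S R' S' ->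
  covers (mirror_deck M) (mirror S) (mirror R) (mirror S') (mirror R').
Proof.
move=> h i j; rewrite !in_mirror orbC => /h[k [l [hk m]]].
exists (- k - 1), l; rewrite !in_mirror /mirror_deck; split.
  by move: hk; rewrite orbC; have -> : - (- k - 1) - 1 = k by lia.
by move: m; congr M; lia.
Qed.

Lemma redecomposes_transp pi x z R S R' S' :
  redecomposes pi x z R S R' S' ->
  redecomposes (transp_pi pi) x z (transp R) (transp S) (transp R') (transp S').
Proof.
case=> nR nS ns [w m1 m2] [Rl [Sl [M [[s1 s2] hM d1 d2 [c1 c2]]]]].
split; rewrite ?nonempty_transp //.
- move=> [/sim_transp a /sim_transp b]; apply: ns.
  by move: a b; rewrite !transpK.
- by exists w; apply: moves_transp.
exists (transp Rl), (transp Sl), (transp_deck M); split.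
- by split; apply: sim_transp.
- exact: deck_transp.
- exact: develops_transp.
- exact: develops_transp.
- by split; apply: covers_transp.
Qed.

Lemma redecomposes_mirror pi x z R S R' S' : plane_cover pi ->
  redecomposes pi x z R S R' S' ->
  redecomposes (mirror_pi pi) z x (mirror S) (mirror R) (mirror S') (mirror R').
Proof.
move=> hp.
case=> nR nS ns [w m1 m2] [Rl [Sl [M [[s1 s2] hM d1 d2 [c1 c2]]]]].
split; rewrite ?nonempty_mirror //.
- move=> [/(sim_mirror (plane_cover_mirror hp)) a].
  move=> /(sim_mirror (plane_cover_mirror hp)) b; apply: ns.
  by move: a b; rewrite !mirrorK mirror_piK.
- by exists w; apply: moves_mirror.
exists (mirror Sl), (mirror Rl), (mirror_deck M); split.
- by split; apply: (sim_mirror hp).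
- exact: deck_mirror.
- exact: (develops_mirror hM).
- exact: (develops_mirror hM).
- by split; apply: covers_mirror.
Qed.

(** * Recutting two rectangles with a common corner *)

Definition trivial_deck (a b : int) := a = 0 /\ b = 0.
Definition cyclic_deck (W H a b : int) := exists c : int, a = c * W /\ b = c * H.

Lemma deck_trivial pi : deck_group pi trivial_deck.
Proof.
split=> // [? ? ? ? [-> ->] [-> ->]|? ? [-> ->]|? ? ? ? [-> ->]].
- by rewrite !addr0.
- by rewrite oppr0.
- by rewrite !addr0.
Qed.

Lemma deck_cyclic pi W H :
  (forall i j, pi (i + W) (j + H) = pi i j) -> deck_group pi (cyclic_deck W H).
Proof.
move=> hp.
have hn : forall (m : nat) i j, pi (i + m%:Z * W) (j + m%:Z * H) = pi i j.
  elim=> [|m IH] i j; first by rewrite !mul0r !addr0.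
  by rewrite -[RHS]IH -[RHS]hp intS; congr pi; ring.
split.
- by exists 0; rewrite !mul0r.
- by move=> ? ? ? ? [c [-> ->]] [d [-> ->]]; exists (c + d); rewrite !mulrDl.
- by move=> ? ? [c [-> ->]]; exists (- c); rewrite !mulNr.
- move=> ? ? i j [c [-> ->]]; case: c => m; first exact: hn.
  by rewrite NegzE -[LHS](hn m.+1); congr pi; ring.
Qed.

(** In the plane the two rectangles touch only along the line through the common corner. The three
    inequalities between corners exclude the other three gluings in [concat]. *)
Lemma develops_side_trivial pi R S : nonempty R -> nonempty S ->
  x0 S = x1 R -> y0 S = y0 R ->
  lr pi R <> ul pi R -> ll pi S <> ur pi S -> ul pi R <> ur pi S ->
  develops pi trivial_deck R S.
Proof.
rewrite /nonempty => hR hS ex ey nR nS nRS.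
have glue : lr pi R = ll pi S by rewrite /lr /ll ex ey.
split; rewrite /develops1 /trivial_deck /in_rect => i j k l hi hk.
- by split; lia.
- by split; lia.
- lia.
- by split=> [|[_]]; [split; [exact: glue | lia..] | lia].
- by split=> [|[/nRS]]; lia.
- by split=> [|[]]; [lia | rewrite -glue => /esym /nR].
- by split=> [|[]]; [lia | rewrite glue => /nS].
Qed.

(** The period carries the upper left corner of [R] to the upper right corner of [S], so that the
    left edge of [R] is glued to the right edge of [S] from their tops. *)
Lemma develops_side_cyclic pi R S : nonempty R -> nonempty S ->
  x0 S = x1 R -> y0 S = y0 R ->
  lr pi R <> ul pi R -> ll pi S <> ur pi S -> ul pi R = ur pi S ->
  develops pi (cyclic_deck (x1 S - x0 R) (y1 S - y1 R)) R S.
Proof.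
rewrite /nonempty => hR hS ex ey nR nS eRS.
have glue : lr pi R = ll pi S by rewrite /lr /ll ex ey.
(* Together [R] and [S] are exactly one period wide, so horizontal displacements determine the
   multiplier of the period: it is 0, or -1 on passing from the right edge of [S] to the left edge
   of [R]. *)
have m0 (a c W : int) : a = c * W -> - W < a < W -> c = 0 by nia.
have m1 (a c W : int) : a = c * W -> - W - W < a < 0 -> c = -1 by nia.
split; rewrite /develops1 /cyclic_deck /in_rect => i j k l hi hk.
- by split=> -[c [e1 e2]]; have c0 : c = 0 by [apply: (m0 _ _ _ e1); lia];
    rewrite c0 mul0r in e1 e2; lia.
- by split=> -[c [e1 e2]]; have c0 : c = 0 by [apply: (m0 _ _ _ e1); lia];
    rewrite c0 mul0r in e1 e2; lia.
- move=> [c [e1 e2]]; have c0 : c = 0 by apply: (m0 _ _ _ e1); lia.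
  by rewrite c0 mul0r in e1 e2; lia.
- split=> [[c [e1 e2]]|[_ *]]; last by exists 0; lia.
  have c0 : c = 0 by apply: (m0 _ _ _ e1); lia.
  by rewrite c0 mul0r in e1 e2; split; [exact: glue | lia..].
- split=> [[c [e1 e2]]|[_ *]]; last by exists (-1); lia.
  have c0 : c = -1 by apply: (m1 _ _ _ e1); lia.
  by rewrite c0 !mulN1r in e1 e2; split; [exact: eRS | lia..].
- split=> [[c [e1 e2]]|[]]; last by rewrite -glue => /esym /nR.
  have c0 : c = 0 by apply: (m0 _ _ _ e1); lia.
  by rewrite c0 mul0r in e1 e2; lia.
- split=> [[c [e1 e2]]|[]]; last by rewrite glue => /nS.
  have c0 : c = 0 by apply: (m0 _ _ _ e1); lia.
  by rewrite c0 mul0r in e1 e2; lia.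
Qed.

(** Reflection followed by transposition is a quarter turn that reverses the order of the pair. It
    carries [R] on top of [S], with right sides aligned, to two rectangles side by side with bottoms
    aligned. *)
Lemma develops_above pi M R S :
  deck_group pi M ->
  develops (transp_pi (mirror_pi pi)) (transp_deck (mirror_deck M))
    (transp (mirror S)) (transp (mirror R)) ->
  develops pi M R S.
Proof.
move=> hM /develops_transp; rewrite !transpK.
move=> /(develops_mirror (deck_mirror hM)); rewrite !mirrorK mirror_piK.
by congr develops; apply/funext => i; apply/funext => j;
  rewrite /mirror_deck /transp_deck opprK.
Qed.

Lemma develops_above_trivial pi R S : nonempty R -> nonempty S ->
  y1 S = y0 R -> x1 S = x1 R ->
  lr pi R <> ul pi R -> ll pi S <> ur pi S -> ul pi R <> ll pi S ->
  develops pi trivial_deck R S.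
Proof.
move=> hR hS ey ex nR nS nRS; apply: develops_above (deck_trivial _) _.
have -> : transp_deck (mirror_deck trivial_deck) = trivial_deck.
  apply/funext => i; apply/funext => j; apply/propext.
  by rewrite /transp_deck /mirror_deck /trivial_deck; split; lia.
apply: develops_side_trivial; rewrite ?nonempty_transp ?nonempty_mirror //=.
- by rewrite ex.
all: rewrite /ll /lr /ul /ur /transp_pi /mirror_pi /= !opprK.
all: by [exact: nS | exact: nR | exact: nesym nRS | exact: nesym nS | exact: nesym nR].
Qed.

(** The period carries the lower left corner of [S] to the upper left corner of [R]. It is kept as
    parameters [W] and [H] so that it can be matched with the period of the pair being recut. *)
Lemma develops_above_cyclic pi R S (W H : int) : nonempty R -> nonempty S ->
  y1 S = y0 R -> x1 S = x1 R ->
  lr pi R <> ul pi R -> ll pi S <> ur pi S -> ul pi R = ll pi S ->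
  W = x0 R - x0 S -> H = y1 R - y0 S -> deck_group pi (cyclic_deck W H) ->
  develops pi (cyclic_deck W H) R S.
Proof.
move=> hR hS ey ex nR nS eRS eW eH hM; apply: develops_above hM _.
have -> : transp_deck (mirror_deck (cyclic_deck W H)) =
  cyclic_deck (y1 R - y0 S) (x0 S - x0 R).
  apply/funext => i; apply/funext => j; apply/propext.
  rewrite /transp_deck /mirror_deck /cyclic_deck eW eH.
  by split=> -[c [e1 e2]]; exists c; split => //; lia.
have -> : x0 S - x0 R = y1 (transp (mirror R)) - y1 (transp (mirror S)).
  by rewrite /=; lia.
have -> : y1 R - y0 S = x1 (transp (mirror R)) - x0 (transp (mirror S)) by [].
apply: develops_side_cyclic; rewrite ?nonempty_transp ?nonempty_mirror //=.
- by rewrite ex.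
all: rewrite /ll /lr /ul /ur /transp_pi /mirror_pi /= !opprK.
all: by [exact: nesym nS | exact: nesym nR | exact: nS | exact: nR | exact: esym eRS].
Qed.

Definition moved pi x R := (x :\: [set ll pi R; ur pi R]) :|: [set lr pi R; ul pi R].

(** A point of [x] at the lower right or upper left corner would share a line with each of the other
    two corners, and so identify them. *)
Lemma moves_moved pi x R : plane_cover pi -> one_per_line pi x ->
  ll pi R \in x -> ur pi R \in x -> ll pi R <> ur pi R ->
  [/\ moves pi x (moved pi x R) R, lr pi R \notin x & ul pi R \notin x].
Proof.
move=> hp [hr hc] hll hur nlu.
have nlr : lr pi R \notin x.
  by apply/negP => h; apply: nlu; exact: etrans (esym (hr _ _ _ h hll)) (hc _ _ _ h hur).
have nul : ul pi R \notin x.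
  by apply/negP => h; apply: nlu; exact: etrans (esym (hc _ _ _ h hll)) (hr _ _ _ h hur).
(* A coincidence of these corners, shifted left by the width, would put [ll] on the horizontal line
   of [ur]. *)
have nt : lr pi R <> ul pi R.
  move=> e; have e' := cover_shift hp (x0 R - x1 R) 0 e.
  rewrite !addr0 addrC subrK in e'.
  by apply: nlu; rewrite /ll e'; apply: hr hur; rewrite -e'.
split=> //; split=> //; rewrite ?inE ?eqxx ?orbT //.
have ne u v : u \in x -> v \notin x -> (u == v) = false.
  by move=> hu; apply: contraNF => /eqP <-.
move=> t; rewrite /corners /moved !inE.
have [->|n1] := eqVneq t (ll pi R).
  rewrite hll /=; move/eqP/negPf: nlu => ->.
  by rewrite !(ne _ _ hll).
have [->|n2] := eqVneq t (ur pi R); first by rewrite hur !(ne _ _ hur).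
have [->|n3] := eqVneq t (lr pi R).
  by rewrite (negPf nlr); move/eqP/negPf: nt => ->.
have [->|n4] := eqVneq t (ul pi R); first by rewrite (negPf nul).
by rewrite /= orbF; clear; lia.
Qed.

(** * The normal form: [S] to the right of [R], bottoms aligned, [R] lower than [S] *)

Section Side.
Variables (pi : int -> int -> T) (x y z : {set T}) (R S : rect).
Hypotheses (hp : plane_cover pi)
  (lx : one_per_line pi x) (ly : one_per_line pi y)
  (mR : moves pi x y R) (mS : moves pi y z S) (nR : nonempty R) (nS : nonempty S)
  (eX : x0 S = x1 R) (eY : y0 S = y0 R) (hRS : y1 R < y1 S).

Let glue : lr pi R = ll pi S. Proof. by rewrite /lr /ll eX eY. Qed.

Let in_w (w : {set T}) R' (mw : moves pi x w R') t :
  t \in x -> t <> ll pi R' -> t <> ur pi R' -> t \in w.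
Proof.
move=> tx /eqP/negPf a /eqP/negPf b; have := moves_eq mw t.
by rewrite /corners tx a b; case: (t \in w); clear; lia.
Qed.

(* An L-shaped polygon, cut horizontally at the upper right corner of R. *)
Lemma redecompose_side_hook : ul pi R <> ur pi S ->
  exists R' S', redecomposes pi x z R S R' S'.
Proof.
move=> nRS.
have P1x := moves_ll mR; have P2x := moves_ur mR.
(* The point [ur pi S] lies in [y] and is not one of the corners that [R] adds, so it was already in
   [x]. As indicators are at most 1, [moves_eq] also separates it from the corners that [R]
   removes. *)
have [P3x P31 P32] : [/\ ur pi S \in x, ur pi S <> ll pi R & ur pi S <> ur pi R].
  have := moves_eq mR (ur pi S); rewrite /corners (moves_ur mS).
  have /eqP/negPf -> : ur pi S <> lr pi R by rewrite glue => /esym /(moves_src mS).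
  have /eqP/negPf -> : ur pi S <> ul pi R by move=> /esym /nRS.
  by case: (_ \in x); case: eqP; case: eqP => //; clear; lia.
have [Q2z Q2Z1] : ul pi R \in z /\ lr pi S <> ul pi R.
  have := moves_eq mS (ul pi R); rewrite /corners (moves_ul mR).
  have /eqP/negPf -> : ul pi R <> ll pi S by rewrite -glue => /esym /(moves_tgt mR).
  have /eqP/negPf -> := nRS.
  rewrite [_ == lr _ _]eq_sym; case: eqP => e; first by case: (_ \in z); clear; lia.
  by case: (_ \in z) => //; case: eqP; clear; lia.
have [mw nlr nul] := moves_moved (R := MkRect (x1 R) (y1 R) (x1 S) (y1 S)) hp lx
  P2x P3x (nesym P32).
set R3 := MkRect (x1 R) _ _ _ in mw nlr nul.
pose R4 := MkRect (x0 R) (y0 R) (x1 S) (y1 R).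
have lrR3 : lr pi R3 = ur pi R4 by [].
have P1w : ll pi R4 \in moved pi x R3.
  by apply: (in_w mw) => //; [exact: moves_src mR | exact: nesym].
have n4 : ll pi R4 <> ur pi R4 by move=> e; move: nlr; rewrite lrR3 -e P1x.
have h3 : nonempty R3.
  by case/andP: nS => lS _; rewrite /nonempty /= -eX lS hRS.
have h4 : nonempty R4.
  by rewrite /nonempty /= (andP nR).2 (lt_trans (andP nR).1) // -eX (andP nS).1.
exists R3, R4; split => //.
- by move=> [[/(moves_src mR)]].
- exists (moved pi x R3) => //; split => //; first last.
  + by move=> e; apply: Q2Z1; rewrite /lr eY; exact: e.
  + by have := moves_lr mS; rewrite /lr eY.
  + exact: (moves_lr mw).
  (* The second new move is the sum of the two old moves minus the first new one; the corners inside
     the polygon cancel. *)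
  move=> t; have -> : (t \in moved pi x R3)%:Z - (t \in z)%:Z =
      ((t \in y)%:Z - (t \in z)%:Z) + ((t \in x)%:Z - (t \in y)%:Z)
      - ((t \in x)%:Z - (t \in moved pi x R3)%:Z) by ring.
  rewrite (moves_eq mw) (moves_eq mR) (moves_eq mS).
  rewrite /corners -glue lrR3.
  have -> : ll pi R3 = ur pi R by [].
  have -> : ur pi R3 = ur pi S by [].
  have -> : ul pi R3 = ul pi S by rewrite /ul /= eX.
  have -> : ll pi R4 = ll pi R by [].
  have -> : lr pi R4 = lr pi S by rewrite /lr eY.
  have -> : ul pi R4 = ul pi R by [].
  by ring.
exists R, S, trivial_deck; split.
- by split; split.
- exact: deck_trivial.
- by apply: develops_side_trivial => //; [exact: moves_tgt mR | exact: moves_src mS].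
- apply: develops_above_trivial => //; first exact: moves_tgt mw.
  (* Shifted down by the height of [S], the coincidence would put [lr pi R] on the vertical line of
     [ul pi R], where [y] has only one point. *)
  move=> e; apply: (moves_tgt mR).
  have := cover_shift hp 0 (y0 R - y1 S) e.
  rewrite /= !addr0 [y1 S + _]addrC subrK => lly.
  rewrite /lr lly; apply: (proj2 ly); last exact: (moves_ul mR).
  by rewrite -lly; exact: (moves_lr mR).
- move: nS nR hRS eX eY; rewrite /covers /in_rect /nonempty /=; clear => ? ? ? ? ?.
  by split=> i j h; exists i, j; rewrite /trivial_deck; split; lia.
Qed.

(* The polygon lifts to a staircase strip invariant under (W, H).  The horizontal
   cut to the right of the upper right corner of R ends below the lower left
   corner of the k-th translate of R, for the least k with y1 R < y0 R + k * H;
   the partner is bounded by the horizontal cuts through these two corners. *)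
Lemma redecompose_side_spiral : ul pi R = ur pi S ->
  exists R' S', redecomposes pi x z R S R' S'.
Proof.
move=> eRS.
have P1x := moves_ll mR; have P2x := moves_ur mR.
have W0 : 0 < x1 S - x0 R by move: nS nR eX; rewrite /nonempty; clear; lia.
have H0 : 0 < y1 S - y1 R by rewrite subr_gt0.
move eW : (x1 S - x0 R) W0 => W W0; move eH : (y1 S - y1 R) H0 => H H0.
(* The translation by [(W, H)] carries the upper left corner of [R] to the upper right corner of
   [S], which project to the same point, so it is a period of [pi]. *)
have hM : deck_group pi (cyclic_deck W H).
  apply: deck_cyclic => i j.
  have := cover_shift hp (i - x0 R) (j - y1 R) eRS.
  rewrite addrC subrK [y1 R + _]addrC subrK => ->.
  by congr pi; rewrite -?eW -?eH; clear; lia.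
have hD (c : int) i j : pi (i + c * W) (j + c * H) = pi i j.
  by apply: (deck_cover hM); exists c.
have [k [hk0 hk1 hk2]] : exists k : int,
    [/\ 0 < k, (k - 1) * H < y1 R - y0 R & y1 R - y0 R < k * H].
  have e := divz_eq (y1 R - y0 R) H; exists (((y1 R - y0 R) %/ H)%Z + 1).
  (* If [H] divided the height of [R], a translate of its lower left corner would lie level with its
     upper right corner, and these two points of [x] would coincide. *)
  have : ((y1 R - y0 R) %% H)%Z <> 0.
    move=> r0; rewrite r0 addr0 in e.
    have e1 : ll pi R = pi (x0 R + ((y1 R - y0 R) %/ H)%Z * W) (y1 R).
      by rewrite /ll -(hD ((y1 R - y0 R) %/ H)%Z) -e [y0 R + _]addrC subrK.
    apply: (moves_src mR); rewrite e1; apply: (proj1 lx) P2x.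
    by rewrite -e1.
  have := modz_ge0 (y1 R - y0 R) (lt0r_neq0 H0).
  have := ltz_pmod (y1 R - y0 R) H0.
  have : 0 < y1 R - y0 R by move: nR; rewrite /nonempty; clear; lia.
  move: e H0; move: (divz _ _) (modz _ _) => q r; move: (y1 R - y0 R); clear.
  by move=> h e H0 h0 r1 r0 rn; split; [nia | lia | lia].
(* The upper right corner of [R3] is the [k]-th translate of the lower left corner of [R]. In [R4]
   the lower left, lower right and upper left corners are the translates of [ul R3], [lr S] and
   [ul S] by -1, [k - 1] and -1 periods. *)
pose R3 := MkRect (x1 R) (y1 R) (x0 R + k * W) (y0 R + k * H).
pose R4 := MkRect (x1 R - W) (y0 R + (k - 1) * H) (x0 R + k * W) (y1 R).
have ur3 : ur pi R3 = ll pi R by rewrite /ur hD.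
have ll3 : ll pi R3 = ur pi R by [].
have ll4 : ul pi R3 = ll pi R4.
  by rewrite /ul /ll /= -[RHS](hD 1); congr pi; ring.
have lr4 : lr pi R4 = lr pi S.
  by rewrite /lr /= -[RHS](hD (k - 1)) eY; congr pi; rewrite -eW; clear; ring.
have ul4 : ul pi R4 = ul pi S.
  by rewrite /ul /= -[LHS](hD 1) eX; congr pi; rewrite -?eH; clear; ring.
have lrR3 : lr pi R3 = ur pi R4 by [].
have kW : W <= k * W by rewrite ler_peMl ?(ltW W0) // -gtz0_ge1.
have l4 : x1 R < x0 R + k * W.
  by case/andP: nS => lS _; move: lS kW eW eX; clear; lia.
have h3 : nonempty R3.
  by rewrite /nonempty /= l4 -ltrBlDl.
have h4 : nonempty R4.
  rewrite /nonempty /= [y0 R + _]addrC -[_ + y0 R < _]ltrBrDr hk1.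
  by rewrite (lt_trans _ l4) // gtrBl.
have [mw nlr nul] : [/\ moves pi x (moved pi x R3) R3, lr pi R3 \notin x &
    ul pi R3 \notin x].
  apply: (moves_moved hp lx); rewrite ?ur3 ?ll3 //.
  exact: nesym (moves_src mR).
have n4 : ll pi R4 <> ur pi R4.
  by rewrite -ll4 -lrR3; exact: nesym (moves_tgt mw).
exists R3, R4; split => //.
- by move=> [[/(moves_src mR)]].
- exists (moved pi x R3) => //; split => //; first last.
  + by rewrite lr4 ul4; exact: (moves_tgt mS).
  + by rewrite ul4; exact: (moves_ul mS).
  + by rewrite lr4; exact: (moves_lr mS).
  + exact: (moves_lr mw).
  + by rewrite -ll4; exact: (moves_ul mw).
  move=> t; have -> : (t \in moved pi x R3)%:Z - (t \in z)%:Z =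
      ((t \in y)%:Z - (t \in z)%:Z) + ((t \in x)%:Z - (t \in y)%:Z)
      - ((t \in x)%:Z - (t \in moved pi x R3)%:Z) by ring.
  rewrite (moves_eq mw) (moves_eq mR) (moves_eq mS).
  rewrite /corners -glue lrR3 ur3 ll3 -ll4 lr4 ul4 -eRS.
  by ring.
exists R, S, (cyclic_deck W H); split.
- by split; split.
- exact: hM.
- rewrite -eW -eH; apply: develops_side_cyclic => //.
    exact: moves_tgt mR.
  exact: moves_src mS.
- apply: develops_above_cyclic => //=; [exact: moves_tgt mw | clear; ring | clear; ring].
- move: nS nR hRS eX eY hk0 hk1 hk2 eW eH W0 H0.
  rewrite /covers /in_rect /nonempty /=; clear.
  move=> hnS hnR hRS eX eY hk0 hk1 hk2 eW eH W0 H0.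
  have mulr_lt (u v c : int) : 0 < c -> u * c < v * c -> u < v by nia.
  have mulr_le (u v c : int) : 0 <= c -> u <= v -> u * c <= v * c by nia.
  have mulr_le_inv (u v c : int) : 0 < c -> u * c < (v + 1) * c -> u <= v.
    by nia.
  split=> i j h.
    (* Together [R3] and [R4] are exactly one period high, with top at [y0 R + k * H], so division
       by [H] finds the translate that lands in them. *)
    have eh := divz_eq (y0 R + k * H - 1 - j) H; have Hn0 : H != 0 by lia.
    have := modz_ge0 (y0 R + k * H - 1 - j) Hn0.
    have := ltz_pmod (y0 R + k * H - 1 - j) H0.
    set q := (_ %/ _)%Z in eh; set r := (_ %% _)%Z in eh * => r1 r0.
    exists (i + q * W), (j + q * H); split; last by exists q; lia.
    have qk : q < k by apply: mulr_lt H0 _; lia.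
    have qW : q * W <= (k - 1) * W by apply: mulr_le (ltW W0) _; lia.
    have q1 : -1 <= q by apply: mulr_le_inv H0 _; lia.
    have qW1 : -1 * W <= q * W by apply: mulr_le (ltW W0) _; lia.
    case/orP: h => h.
      have q0 : -1 < q by apply: mulr_lt H0 _; lia.
      have qW0 : 0 * W <= q * W by apply: mulr_le (ltW W0) _; lia.
      have [jd|jd] := lerP (y1 R) (j + q * H); last by apply/orP; right; lia.
      have q2 : 0 < q by apply: mulr_lt H0 _; lia.
      have qW2 : 1 * W <= q * W by apply: mulr_le (ltW W0) _; lia.
      by apply/orP; left; lia.
    have [jd|jd] := lerP (y1 R) (j + q * H); last by apply/orP; right; lia.
    have q2 : -1 < q by apply: mulr_lt H0 _; lia.
    have qW2 : 0 * W <= q * W by apply: mulr_le (ltW W0) _; lia.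
    by apply/orP; left; lia.
  (* Conversely [R] and [S] are together one period wide, starting at [x0 R], so here the translate
     is found by division by [W]. *)
  have eh := divz_eq (i - x0 R) W; have Wn0 : W != 0 by lia.
  have := modz_ge0 (i - x0 R) Wn0; have := ltz_pmod (i - x0 R) W0.
  set q := (_ %/ _)%Z in eh; set r := (_ %% _)%Z in eh * => r1 r0.
  exists (i - q * W), (j - q * H); split; last by exists (- q); lia.
  have qk : q < k by apply: mulr_lt W0 _; lia.
  have qH : q * H <= (k - 1) * H by apply: mulr_le (ltW H0) _; lia.
  have q1 : -1 <= q by apply: mulr_le_inv W0 _; lia.
  have qH1 : -1 * H <= q * H by apply: mulr_le (ltW H0) _; lia.
  case/orP: h => h.
    have q0 : -1 < q by apply: mulr_lt W0 _; lia.
    have qH0 : 0 * H <= q * H by apply: mulr_le (ltW H0) _; lia.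
    have [jd|jd] := lerP (x1 R) (i - q * W); first by apply/orP; right; lia.
    have q2 : 0 < q by apply: mulr_lt W0 _; lia.
    have qH2 : 1 * H <= q * H by apply: mulr_le (ltW H0) _; lia.
    by apply/orP; left; lia.
  have [jd|jd] := lerP (x1 R) (i - q * W); first by apply/orP; right; lia.
  have q2 : -1 < q by apply: mulr_lt W0 _; lia.
  have qH2 : 0 * H <= q * H by apply: mulr_le (ltW H0) _; lia.
  by apply/orP; left; lia.
Qed.
End Side.

(** * Reduction of all positions of the common corner to the normal form *)

Lemma sim_sym pi R R' : sim pi R R' -> sim pi R' R.
Proof. by case=> a b c; split. Qed.

Lemma sim_trans pi R1 R2 R3 : sim pi R1 R2 -> sim pi R2 R3 -> sim pi R1 R3.
Proof. by case=> a b c [d e f]; split; [rewrite a | lia | lia]. Qed.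

Lemma sim_corners pi R R' : plane_cover pi -> sim pi R R' ->
  [/\ ll pi R = ll pi R', lr pi R = lr pi R', ul pi R = ul pi R' &
      ur pi R = ur pi R'].
Proof.
move=> hp [e ew eh]; have sh u v := cover_shift hp u v e.
have ex : x0 R + (x1 R - x0 R) = x1 R by lia.
have ex' : x0 R' + (x1 R - x0 R) = x1 R' by lia.
have ey : y0 R + (y1 R - y0 R) = y1 R by lia.
have ey' : y0 R' + (y1 R - y0 R) = y1 R' by lia.
split=> //.
- by have := sh (x1 R - x0 R) 0; rewrite !addr0 ex ex'.
- by have := sh 0 (y1 R - y0 R); rewrite !addr0 ey ey'.
- by have := sh (x1 R - x0 R) (y1 R - y0 R); rewrite ex ex' ey ey'.
Qed.

Lemma moves_sim pi x y R R' : plane_cover pi -> sim pi R R' ->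
  moves pi x y R -> moves pi x y R'.
Proof.
move=> hp /(sim_corners hp)[e1 e2 e3 e4] [a b c d e f g].
by split; rewrite -?e1 -?e2 -?e3 -?e4 // => t; rewrite a /corners e1 e2 e3 e4.
Qed.

Lemma redecomposes_sim pi x z R S S1 R' S' : sim pi S S1 ->
  redecomposes pi x z R S1 R' S' -> redecomposes pi x z R S R' S'.
Proof.
move=> s [a b c d [Rl [Sl [M [[s1 s2] e f g h]]]]]; split=> //.
  by move=> [h1 h2]; apply: c; split=> //; apply: sim_trans (sim_sym s) h2.
by exists Rl, Sl, M; split=> //; split=> //; apply: sim_trans s s2.
Qed.

Record two_moves pi x y z R S : Prop := TwoMoves {
  tm_cover : plane_cover pi;
  tm_src : one_per_line pi x;
  tm_mid : one_per_line pi y;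
  tm_tgt : one_per_line pi z;
  tm_fst : moves pi x y R;
  tm_snd : moves pi y z S;
  tm_ne1 : nonempty R;
  tm_ne2 : nonempty S }.

Lemma two_moves_transp pi x y z R S : two_moves pi x y z R S ->
  two_moves (transp_pi pi) x y z (transp R) (transp S).
Proof.
case=> *; split; rewrite ?nonempty_transp //;
  by [exact: plane_cover_transp | exact: one_per_line_transp | exact: moves_transp].
Qed.

Lemma two_moves_mirror pi x y z R S : two_moves pi x y z R S ->
  two_moves (mirror_pi pi) z y x (mirror S) (mirror R).
Proof.
case=> *; split; rewrite ?nonempty_mirror //;
  by [exact: plane_cover_mirror | exact: one_per_line_mirror | exact: moves_mirror].
Qed.

Definition redecomposable pi x z R S :=
  exists R' S', redecomposes pi x z R S R' S'.

Lemma redecomposable_transp pi x z R S :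
  redecomposable (transp_pi pi) x z (transp R) (transp S) ->
  redecomposable pi x z R S.
Proof.
case=> R' [S' /redecomposes_transp]; rewrite !transpK => h.
by exists (transp R'), (transp S').
Qed.

Lemma redecomposable_mirror pi x z R S : plane_cover pi ->
  redecomposable (mirror_pi pi) z x (mirror S) (mirror R) ->
  redecomposable pi x z R S.
Proof.
move=> hp [S' [R' /(redecomposes_mirror (plane_cover_mirror hp))]].
rewrite !mirrorK mirror_piK => h.
by exists (mirror R'), (mirror S').
Qed.

(** Replacing [S] by its lift [S1] attached to [R] at the common corner gives the normal form.
    Whether [ul R] and [ur S1] also agree decides between the spiral and the L-shape. *)
Lemma redecomposable_lt pi x y z R S : two_moves pi x y z R S ->
  lr pi R = ll pi S -> y1 R - y0 R < y1 S - y0 S ->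
  redecomposable pi x z R S.
Proof.
case=> hp lx ly lz mR mS nR nS e lt.
pose S1 := MkRect (x1 R) (y0 R) (x1 R + (x1 S - x0 S)) (y0 R + (y1 S - y0 S)).
have s1 : sim pi S S1 by split; [rewrite -e | rewrite /=; lia..].
have nS1 : nonempty S1 by move: nS; rewrite /nonempty /=; lia.
have mS1 := moves_sim hp s1 mS.
have lt1 : y1 R < y1 S1 by rewrite /=; lia.
have [eRS|/eqP nRS] := eqVneq (ul pi R) (ur pi S1).
  have [R' [S' h]] := redecompose_side_spiral hp lx mR mS1 nR nS1 erefl erefl lt1 eRS.
  by exists R', S'; apply: redecomposes_sim s1 h.
have [R' [S' h]] := redecompose_side_hook hp lx ly mR mS1 nR nS1 erefl erefl lt1 nRS.
by exists R', S'; apply: redecomposes_sim s1 h.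
Qed.

(** If [R] is the taller rectangle, reflection makes it the second one and keeps the type of the
    common corner. *)
Lemma redecomposable_lrll pi x y z R S : two_moves pi x y z R S ->
  lr pi R = ll pi S -> y1 R - y0 R <> y1 S - y0 S ->
  redecomposable pi x z R S.
Proof.
move=> h e ne.
have [lt|le] := ltrP (y1 R - y0 R) (y1 S - y0 S); first exact: redecomposable_lt h e lt.
apply: (redecomposable_mirror (tm_cover h)).
apply: (redecomposable_lt (two_moves_mirror h)); last by rewrite /=; lia.
by rewrite /lr /ll /mirror_pi /= !opprK; exact: esym e.
Qed.

(** Transposition exchanges [lr] with [ul] and fixes [ll]. The other two positions follow by
    reflecting this one and transposing again. *)
Lemma redecomposable_ulll pi x y z R S : two_moves pi x y z R S ->
  ul pi R = ll pi S -> x1 R - x0 R <> x1 S - x0 S ->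
  redecomposable pi x z R S.
Proof.
move=> h e ne; apply: redecomposable_transp.
exact: (redecomposable_lrll (two_moves_transp h)).
Qed.

Lemma redecomposable_lrur pi x y z R S : two_moves pi x y z R S ->
  lr pi R = ur pi S -> x1 R - x0 R <> x1 S - x0 S ->
  redecomposable pi x z R S.
Proof.
move=> h e ne; apply: (redecomposable_mirror (tm_cover h)).
apply: (redecomposable_ulll (two_moves_mirror h)); last by rewrite /=; lia.
by rewrite /ul /ll /mirror_pi /= !opprK; exact: esym e.
Qed.

Lemma redecomposable_ulur pi x y z R S : two_moves pi x y z R S ->
  ul pi R = ur pi S -> y1 R - y0 R <> y1 S - y0 S ->
  redecomposable pi x z R S.
Proof.
move=> h e ne; apply: redecomposable_transp.
exact: (redecomposable_lrur (two_moves_transp h)).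
Qed.

(** * Counting quadrants *)

Definition cells R : finType := ('I_`|x1 R - x0 R| * 'I_`|y1 R - y0 R|)%type.
Definition cx R (c : cells R) : int := x0 R + c.1%:Z.
Definition cy R (c : cells R) : int := y0 R + c.2%:Z.

Lemma in_cell R (c : cells R) : nonempty R -> in_rect R (cx c) (cy c).
Proof.
case: R c => a b a' b' [[i hi] [j hj]]; rewrite /nonempty /in_rect /cx /cy /=.
by move: hi hj; rewrite /=; clear; lia.
Qed.

Lemma cell_ex R i j : in_rect R i j -> exists c : cells R, cx c = i /\ cy c = j.
Proof.
move=> h; have hi : (`|i - x0 R| < `|x1 R - x0 R|)%N by move: h; rewrite /in_rect; lia.
have hj : (`|j - y0 R| < `|y1 R - y0 R|)%N by move: h; rewrite /in_rect; lia.
exists (Ordinal hi, Ordinal hj); rewrite /cx /cy /=.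
by move: h; rewrite /in_rect; clear; lia.
Qed.

Lemma cell_inj R (c d : cells R) : cx c = cx d -> cy c = cy d -> c = d.
Proof.
case: c d => [i j] [k l]; rewrite /cx /cy /= => /addrI[e1] /addrI[e2].
by congr pair; apply: val_inj.
Qed.

Definition tiles R S : finType := (cells R + cells S)%type.
Definition tx R S (c : tiles R S) : int :=
  match c with inl c => cx c | inr c => cx c end.
Definition ty R S (c : tiles R S) : int :=
  match c with inl c => cy c | inr c => cy c end.

Lemma tile_ex R S i j : in_rect R i j || in_rect S i j ->
  exists c : tiles R S, tx c = i /\ ty c = j.
Proof. by case/orP=> /cell_ex[c h]; [exists (inl c) | exists (inr c)]. Qed.

Lemma in_tile R S (c : tiles R S) : nonempty R -> nonempty S ->
  in_rect R (tx c) (ty c) || in_rect S (tx c) (ty c).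
Proof. by case: c => c hR hS /=; rewrite in_cell ?orbT. Qed.

Lemma tile_inj pi M R S (c d : tiles R S) : deck_group pi M ->
  nonempty R -> nonempty S ->
  develops pi M R S -> M (tx d - tx c) (ty d - ty c) -> c = d.
Proof.
move=> hM hR hS [f s dj _ _ _ _].
case: c d => c [] d /= m.
- have [/(_ m)[] ? ? _ _] := f _ _ _ _ (in_cell c hR) (in_cell d hR).
  by congr inl; apply: cell_inj.
- by have [] := dj _ _ _ _ (in_cell c hR) (in_cell d hS).
- have [] := dj _ _ _ _ (in_cell d hR) (in_cell c hS).
  by have := deckN hM m; rewrite !opprB.
- have [/(_ m)[] ? ? _ _] := s _ _ _ _ (in_cell c hS) (in_cell d hS).
  by congr inr; apply: cell_inj.
Qed.

Record same_dev pi M R S R' S' : Prop := SameDev {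
  sd_deck : deck_group pi M;
  sd_ne : [/\ nonempty R, nonempty S, nonempty R' & nonempty S'];
  sd_dev1 : develops pi M R S;
  sd_dev2 : develops pi M R' S';
  sd_cov1 : covers M R S R' S';
  sd_cov2 : covers M R' S' R S }.

(** Choosing congruent tiles in both directions gives two maps. Their composites send a tile to a
    congruent tile of the same pair, which is the tile itself by [tile_inj]. *)
Lemma tile_bij pi M R S R' S' : same_dev pi M R S R' S' ->
  exists f : tiles R S -> tiles R' S', bijective f /\
    forall c, M (tx (f c) - tx c) (ty (f c) - ty c).
Proof.
case=> hM [nR nS nR' nS'] d d' c1 c2.
have ex (R1 S1 R2 S2 : rect) : nonempty R1 -> nonempty S1 ->
  covers M R1 S1 R2 S2 -> exists f : tiles R1 S1 -> tiles R2 S2,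
  forall c, M (tx (f c) - tx c) (ty (f c) - ty c).
  move=> n1 n2 hc; suff /choice[f hf] : forall c : tiles R1 S1,
    exists e : tiles R2 S2, M (tx e - tx c) (ty e - ty c) by exists f.
  move=> c; have [k [l [/tile_ex[e [<- <-]] m]]] := hc _ _ (in_tile c n1 n2).
  by exists e.
have [f hf] := ex _ _ _ _ nR nS c1; have [g hg] := ex _ _ _ _ nR' nS' c2.
exists f; split => //; exists g => c.
  apply: esym; apply: (tile_inj hM nR nS d).
  by have := deckD hM (hg (f c)) (hf c); congr M; clear; lia.
apply: esym; apply: (tile_inj hM nR' nS' d').
by have := deckD hM (hf (g c)) (hg c); congr M; clear; lia.
Qed.

Lemma tile_sum pi M R S R' S' (F : int -> int -> int) :
  same_dev pi M R S R' S' ->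
  (forall i j k l, M (k - i) (l - j) -> F k l = F i j) ->
  \sum_(c : cells R) F (cx c) (cy c) + \sum_(c : cells S) F (cx c) (cy c) =
  \sum_(c : cells R') F (cx c) (cy c) + \sum_(c : cells S') F (cx c) (cy c).
Proof.
move=> /tile_bij[f [bf hf]] hF.
have E (R1 S1 : rect) : \sum_(c : cells R1) F (cx c) (cy c) +
    \sum_(c : cells S1) F (cx c) (cy c) = \sum_(c : tiles R1 S1) F (tx c) (ty c).
  by rewrite big_sumType.
rewrite !E [RHS](reindex f); last exact: onW_bij.
by apply: eq_bigr => c _; apply: esym; apply: hF.
Qed.

(* The number of quadrants at points of x covered by the rectangle, i.e. four
   times the multiplicity n_x. *)
Definition quad (F : int -> int -> int) i j : int :=
  F i j + F (i + 1) j + F i (j + 1) + F (i + 1) (j + 1).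
Definition ind pi x i j : int := (pi i j \in x)%:Z.
Definition count pi x R : int := \sum_(c : cells R) quad (ind pi x) (cx c) (cy c).

Definition mixed (F : int -> int -> int) i j : int :=
  F i j - F (i + 1) j - F i (j + 1) + F (i + 1) (j + 1).

(** Mixed second differences telescope in both directions, leaving only the corners. *)
Lemma sum_mixed (F : int -> int -> int) R : nonempty R ->
  \sum_(c : cells R) mixed F (cx c) (cy c) =
  F (x0 R) (y0 R) - F (x1 R) (y0 R) - F (x0 R) (y1 R) + F (x1 R) (y1 R).
Proof.
move=> hR.
have tel (n : nat) (f : nat -> int) : \sum_(i < n) (f i - f i.+1) = f 0%N - f n.
  rewrite -(big_mkord xpredT (fun i => f i - f i.+1)) /= -[RHS]opprB.
  by rewrite -telescope_sumr // -sumrN; apply: eq_bigr => i _; rewrite opprB.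
pose g i j := F (x0 R + i%:Z) (y0 R + j%:Z) - F (x0 R + i%:Z) (y0 R + j.+1%:Z).
have ex : x0 R + `|x1 R - x0 R|%:Z = x1 R.
  by move: hR; rewrite /nonempty; clear; lia.
have ey : y0 R + `|y1 R - y0 R|%:Z = y1 R.
  by move: hR; rewrite /nonempty; clear; lia.
transitivity (\sum_(c : cells R) (g c.1 c.2 - g c.1.+1 c.2)).
  apply: eq_bigr => c _; rewrite /mixed /g /cx /cy.
  have succ (a : int) (n : nat) : a + n%:Z + 1 = a + n.+1%:Z by rewrite intS; ring.
  by rewrite !succ; ring.
rewrite -(pair_bigA _ (fun (i : 'I_`|x1 R - x0 R|) (j : 'I_`|y1 R - y0 R|) =>
  g i j - g i.+1 j)) /= exchange_big /=.
transitivity (\sum_(j < `|y1 R - y0 R|) (g 0%N j - g `|x1 R - x0 R|%N j)).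
  by apply: eq_bigr => j _; rewrite (tel _ (g ^~ j)).
rewrite sumrB /g ex.
have tel2 a : \sum_(j < `|y1 R - y0 R|) (F a (y0 R + j%:Z) - F a (y0 R + j.+1%:Z))
    = F a (y0 R) - F a (y1 R).
  by rewrite (tel _ (fun j : nat => F a (y0 R + j%:Z))) ey addr0.
by rewrite !tel2 addr0; ring.
Qed.

Lemma corners_sum pi R t : nonempty R ->
  corners pi R t =
  \sum_(c : cells R) mixed (fun i j => (t == pi i j)%:Z) (cx c) (cy c).
Proof.
by move=> hR; rewrite sum_mixed // /corners /ll /lr /ul /ur; ring.
Qed.

(** Coincidences are invariant under common shifts, so only the displacement of the two unit squares
    matters. As a formal sum of displacements the pairing is a product of one factor per direction,
    each odd; hence it is even. *)
Lemma quad_mixed_sym pi i j k l : plane_cover pi ->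
  quad (fun a b => mixed (fun c d => (pi a b == pi c d)%:Z) k l) i j =
  quad (fun a b => mixed (fun c d => (pi a b == pi c d)%:Z) i j) k l.
Proof.
move=> hp.
have sh a b c d u v : (pi (a + u) (b + v) == pi (c + u) (d + v)) = (pi a b == pi c d).
  apply/eqP/eqP => [e|]; last exact: (cover_shift hp).
  by have := cover_shift hp (- u) (- v) e; rewrite !addrK.
have shx a b c d : (pi (a + 1) b == pi (c + 1) d) = (pi a b == pi c d).
  by rewrite -(sh a b c d 1 0) !addr0.
have shy a b c d : (pi a (b + 1) == pi c (d + 1)) = (pi a b == pi c d).
  by rewrite -(sh a b c d 0 1) !addr0.
rewrite /quad /mixed !(shx, shy) ![pi k _ == _]eq_sym ![pi (k + 1) _ == _]eq_sym.
by ring.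
Qed.

(** By [corners_sum] both sides are double sums over the unit squares of [R] and [S], and they agree
    term by term by [quad_mixed_sym]. *)
Lemma count_cross pi x y z R S : plane_cover pi ->
  moves pi x y R -> moves pi y z S -> nonempty R -> nonempty S ->
  count pi y R - count pi z R = count pi x S - count pi y S.
Proof.
move=> hp mR mS nR nS; rewrite /count -!sumrB.
have E (u v : {set T}) Q i j : moves pi u v Q -> nonempty Q ->
    quad (ind pi u) i j - quad (ind pi v) i j =
    \sum_(d : cells Q)
      quad (fun a b => mixed (fun c d => (pi a b == pi c d)%:Z) (cx d) (cy d)) i j.
  move=> mQ nQ.
  transitivity (quad (fun a b => ind pi u a b - ind pi v a b) i j).
    by rewrite /quad; ring.
  have -> : (fun a b => ind pi u a b - ind pi v a b) = fun a b =>
      \sum_(d : cells Q) mixed (fun c d => (pi a b == pi c d)%:Z) (cx d) (cy d).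
    by apply/funext => a; apply/funext => b; rewrite -corners_sum // -(moves_eq mQ).
  by rewrite /quad !big_split.
rewrite (eq_bigr _ (fun c _ => E _ _ _ _ _ mS nS)).
rewrite [RHS](eq_bigr _ (fun c _ => E _ _ _ _ _ mR nR)) exchange_big /=.
by apply: eq_bigr => d _; apply: eq_bigr => c _; apply: quad_mixed_sym.
Qed.

(** With [a] and [b] in {0, 1} this singles out one corner of the unit squares: (0, 0) is the lower
    left and (1, 1) the upper right one. *)
Definition quadrant pi x R (a b : int) : int :=
  \sum_(c : cells R) ind pi x (cx c + a) (cy c + b).

Lemma countE pi x R :
  count pi x R = quadrant pi x R 0 0 + quadrant pi x R 1 0
    + quadrant pi x R 0 1 + quadrant pi x R 1 1.
Proof.
rewrite /count /quadrant -!big_split /=; apply: eq_bigr => c _.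
by rewrite /quad !addr0.
Qed.

Lemma quadrant_ge0 pi x R a b : 0 <= quadrant pi x R a b.
Proof. by apply: sumr_ge0 => c _; rewrite /ind; case: (_ \in _). Qed.

Lemma quadrant_ge1 pi x R a b i j :
  in_rect R (i - a) (j - b) -> pi i j \in x -> 1 <= quadrant pi x R a b.
Proof.
move=> /cell_ex[c [ei ej]] h; rewrite /quadrant (bigD1 c) //= ei ej /ind !subrK h.
by rewrite lerDl; apply: sumr_ge0 => d _; case: (_ \in _).
Qed.

Lemma quadrant_eq0 pi x R a b : nonempty R ->
  (forall i j, in_rect R (i - a) (j - b) -> pi i j \notin x) ->
  quadrant pi x R a b = 0.
Proof.
move=> hR h; apply: big1 => c _; rewrite /ind (negPf (h _ _ _)) //.
by rewrite !addrK; apply: in_cell.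
Qed.

Lemma quadrant_eq1 pi x R a b i0 j0 : nonempty R ->
  in_rect R (i0 - a) (j0 - b) -> pi i0 j0 \in x ->
  (forall i j, in_rect R (i - a) (j - b) -> pi i j \in x -> i = i0 /\ j = j0) ->
  quadrant pi x R a b = 1.
Proof.
move=> hR /cell_ex[c [ei ej]] hx h; rewrite /quadrant (bigD1 c) //= ei ej.
rewrite /ind !subrK hx big1 ?addr0 // => d dc; case hd : (_ \in x) => //.
have hc : in_rect R (cx d + a - a) (cy d + b - b) by rewrite !addrK; apply: in_cell.
have [e1 e2] := h _ _ hc hd.
by case/eqP: dc; apply: cell_inj; rewrite ?ei ?ej -?e1 -?e2 addrK.
Qed.

Definition misses pi x R :=
  forall i j, x0 R < i < x1 R -> y0 R < j < y1 R -> pi i j \notin x.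

Lemma misses_mirror pi x R : misses pi x R -> misses (mirror_pi pi) x (mirror R).
Proof.
by move=> h i j /= hi hj; rewrite /mirror_pi; apply: h => //; move: hi; clear; lia.
Qed.

(** Emptiness extends to the boundary: a point of [x] on an edge shares a line with a corner in [x],
    and as the sides are shorter than [N] it must be that corner. *)
Lemma closed_src pi x y R i j : plane_cover pi -> one_per_line pi x ->
  moves pi x y R -> small R -> misses pi x R ->
  x0 R <= i <= x1 R -> y0 R <= j <= y1 R -> pi i j \in x ->
  (i = x0 R /\ j = y0 R) \/ (i = x1 R /\ j = y1 R).
Proof.
move=> hp [lr lc] mR /andP[s1 s2] hm hi hj h.
have hx := moves_ll mR; have hx' := moves_ur mR; rewrite /ll /ur in hx hx'.
have small0 (u : int) : (N %| u)%Z -> 0 <= u < N -> u = 0.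
  move=> /dvdzP[q ->] hu; have -> : q = 0 by move: hu; clear; nia.
  by rewrite mul0r.
have colN a b c : pi a b = pi a c -> (N %| c - b)%Z.
  move=> e; apply/(cover_col hp a b); by rewrite addrC subrK.
have rowN a b c : pi a b = pi c b -> (N %| c - a)%Z.
  move=> e; apply/(cover_row hp a b); by rewrite addrC subrK.
have [ei|ni] := eqVneq i (x0 R).
  left; split=> //; rewrite ei in h; have /colN/small0 := lc _ _ _ hx h.
  by move: hj s2; clear; lia.
have [ei'|ni'] := eqVneq i (x1 R).
  right; split=> //; rewrite ei' in h; have /colN/small0 := lc _ _ _ h hx'.
  by move: hj s2; clear; lia.
have [ej|nj] := eqVneq j (y0 R).
  left; split=> //; rewrite ej in h; have /rowN/small0 := lr _ _ _ hx h.
  by move: hi s1; clear; lia.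
have [ej'|nj'] := eqVneq j (y1 R).
  right; split=> //; rewrite ej' in h; have /rowN/small0 := lr _ _ _ h hx'.
  by move: hi s1; clear; lia.
have := hm i j; rewrite h.
by move=> /(_ _ _) /negP; case; move: hi hj ni ni' nj nj'; clear; lia.
Qed.

Lemma closed_tgt pi x y R i j : plane_cover pi -> one_per_line pi y ->
  moves pi x y R -> small R -> misses pi y R ->
  x0 R <= i <= x1 R -> y0 R <= j <= y1 R -> pi i j \in y ->
  (i = x1 R /\ j = y0 R) \/ (i = x0 R /\ j = y1 R).
Proof.
move=> hp ly mR sR hm hi hj h.
have sm : small (mirror R) by move: sR; rewrite /small /=; clear; lia.
have := @closed_src (mirror_pi pi) y x (mirror R) (- i) j (plane_cover_mirror hp)
  (one_per_line_mirror ly) (moves_mirror mR) sm (misses_mirror hm).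
rewrite /mirror_pi /= opprK => /(_ _ hj h); move: hi; clear; lia.
Qed.

(** Only the two corners in [x] contribute, with a single quadrant each. *)
Lemma count_src_misses pi x y R : plane_cover pi -> one_per_line pi x ->
  moves pi x y R -> nonempty R -> small R -> misses pi x R -> count pi x R = 2.
Proof.
move=> hp lx mR nR sR hm; rewrite countE.
have cl i j := @closed_src pi x y R i j hp lx mR sR hm.
have nR' : x0 R < x1 R /\ y0 R < y1 R by apply/andP.
rewrite (quadrant_eq1 (i0 := x0 R) (j0 := y0 R) nR); last 3 first.
- by move: nR'; rewrite /in_rect; clear; lia.
- exact: (moves_ll mR).
- by move=> i j hij /cl; move: hij nR'; rewrite /in_rect; clear; lia.
rewrite (quadrant_eq1 (a := 1) (b := 1) (i0 := x1 R) (j0 := y1 R) nR); last 3 first.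
- by move: nR'; rewrite /in_rect; clear; lia.
- exact: (moves_ur mR).
- by move=> i j hij /cl; move: hij nR'; rewrite /in_rect; clear; lia.
rewrite !quadrant_eq0 //.
  by move=> i j hij; apply/negP => /cl; move: hij nR'; rewrite /in_rect; clear; lia.
by move=> i j hij; apply/negP => /cl; move: hij nR'; rewrite /in_rect; clear; lia.
Qed.

Lemma count_tgt_misses pi x y R : plane_cover pi -> one_per_line pi y ->
  moves pi x y R -> nonempty R -> small R -> misses pi y R -> count pi y R = 2.
Proof.
move=> hp ly mR nR sR hm; rewrite countE.
have cl i j := @closed_tgt pi x y R i j hp ly mR sR hm.
have nR' : x0 R < x1 R /\ y0 R < y1 R by apply/andP.
rewrite (quadrant_eq1 (a := 1) (b := 0) (i0 := x1 R) (j0 := y0 R) nR); last 3 first.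
- by move: nR'; rewrite /in_rect; clear; lia.
- exact: (moves_lr mR).
- by move=> i j hij /cl; move: hij nR'; rewrite /in_rect; clear; lia.
rewrite (quadrant_eq1 (a := 0) (b := 1) (i0 := x0 R) (j0 := y1 R) nR); last 3 first.
- by move: nR'; rewrite /in_rect; clear; lia.
- exact: (moves_ul mR).
- by move=> i j hij /cl; move: hij nR'; rewrite /in_rect; clear; lia.
rewrite !quadrant_eq0 //.
  by move=> i j hij; apply/negP => /cl; move: hij nR'; rewrite /in_rect; clear; lia.
by move=> i j hij; apply/negP => /cl; move: hij nR'; rewrite /in_rect; clear; lia.
Qed.

(** The corners in [x] contribute to the quadrants (0, 0) and (1, 1). Equality leaves nothing for
    (1, 0) and (0, 1), where an interior point of [x] would count, and so would a translate by [N]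
    of the lower left corner along an edge of length at least [N]. *)
Lemma count_src pi x y R : 0 < N -> plane_cover pi -> moves pi x y R ->
  nonempty R -> 2 <= count pi x R /\ (count pi x R = 2 -> small R /\ misses pi x R).
Proof.
move=> N0 hp mR nR; rewrite countE.
have nR' : x0 R < x1 R /\ y0 R < y1 R by apply/andP.
have q00 : 1 <= quadrant pi x R 0 0.
  apply: quadrant_ge1 (moves_ll mR).
  by move: nR'; rewrite /in_rect; clear; lia.
have q11 : 1 <= quadrant pi x R 1 1.
  apply: quadrant_ge1 (moves_ur mR).
  by move: nR'; rewrite /in_rect; clear; lia.
have q10 := quadrant_ge0 pi x R 1 0; have q01 := quadrant_ge0 pi x R 0 1.
split=> [|e]; first by move: q00 q11 q10 q01; clear; lia.
have p10 : ~ 1 <= quadrant pi x R 1 0 by move: q00 q11 q01 e; clear; lia.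
have p01 : ~ 1 <= quadrant pi x R 0 1 by move: q00 q11 q10 e; clear; lia.
split.
  rewrite /small; apply/andP; split; rewrite ltNge; apply/negP => hN.
    apply: p10; apply: (@quadrant_ge1 _ _ _ _ _ (x0 R + N) (y0 R)).
      by move: nR' hN N0; rewrite /in_rect; clear; lia.
    by rewrite (proj2 (cover_row hp _ _ _)) ?dvdzz //; exact: (moves_ll mR).
  apply: p01; apply: (@quadrant_ge1 _ _ _ _ _ (x0 R) (y0 R + N)).
    by move: nR' hN N0; rewrite /in_rect; clear; lia.
  by rewrite (proj2 (cover_col hp _ _ _)) ?dvdzz //; exact: (moves_ll mR).
move=> i j hi hj; apply/negP => h; apply: p10; apply: quadrant_ge1 h.
by move: hi hj; rewrite /in_rect; clear; lia.
Qed.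

Lemma count_tgt pi x y R : moves pi x y R ->
  nonempty R -> 2 <= count pi y R /\ (count pi y R = 2 -> misses pi y R).
Proof.
move=> mR nR; rewrite countE.
have nR' : x0 R < x1 R /\ y0 R < y1 R by apply/andP.
have q10 : 1 <= quadrant pi y R 1 0.
  apply: quadrant_ge1 (moves_lr mR).
  by move: nR'; rewrite /in_rect; clear; lia.
have q01 : 1 <= quadrant pi y R 0 1.
  apply: quadrant_ge1 (moves_ul mR).
  by move: nR'; rewrite /in_rect; clear; lia.
have q00 := quadrant_ge0 pi y R 0 0; have q11 := quadrant_ge0 pi y R 1 1.
split=> [|e]; first by move: q00 q11 q10 q01; clear; lia.
have p00 : ~ 1 <= quadrant pi y R 0 0 by move: q10 q11 q01 e; clear; lia.
move=> i j hi hj; apply/negP => h; apply: p00; apply: quadrant_ge1 h.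
by move: hi hj; rewrite /in_rect; clear; lia.
Qed.

Lemma same_dev_count pi M R S R' S' u : same_dev pi M R S R' S' ->
  count pi u R + count pi u S = count pi u R' + count pi u S'.
Proof.
move=> sd; apply: (tile_sum sd) => i j k l m; rewrite /quad /ind.
have dk a b := deck_cover (sd_deck sd) (i + a) (j + b) m.
have e a b : pi (k + a) (l + b) = pi (i + a) (j + b).
  by rewrite -dk; congr pi; ring.
have := e 0 0; have := e 1 0; have := e 0 1.
by rewrite !addr0 !e => -> -> ->.
Qed.

(* The sum of the multiplicities of the two rectangles at their ends is a
   function of the polygon and its ends, and is minimal when both are empty. *)
Lemma same_count_misses pi x y z w R S R' S' : 0 < N ->
  two_moves pi x y z R S -> small R -> small S ->
  misses pi x R -> misses pi y R -> misses pi y S -> misses pi z S ->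
  moves pi x w R' -> moves pi w z S' -> nonempty R' -> nonempty S' ->
  (forall u, count pi u R + count pi u S = count pi u R' + count pi u S') ->
  [/\ small R', small S', misses pi x R' /\ misses pi w R' &
      misses pi w S' /\ misses pi z S'].
Proof.
move=> N0 [hp lx ly lz mR mS nR nS] sR sS hxR hyR hyS hzS mR' mS' nR' nS' sumx.
have e1 := count_src_misses hp lx mR nR sR hxR.
have e2 := count_tgt_misses hp ly mR nR sR hyR.
have e3 := count_src_misses hp ly mS nS sS hyS.
have e4 := count_tgt_misses hp lz mS nS sS hzS.
have c1 := count_cross hp mR mS nR nS.
have c2 := count_cross hp mR' mS' nR' nS'.
have sx := sumx x; have sz := sumx z.
have [f1 g1] := count_src N0 hp mR' nR'; have [f2 g2] := count_tgt mR' nR'.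
have [f3 g3] := count_src N0 hp mS' nS'; have [f4 g4] := count_tgt mS' nS'.
have [h1 h2 h3 h4] : [/\ count pi x R' = 2, count pi w R' = 2,
    count pi w S' = 2 & count pi z S' = 2].
  (* By [count_cross] each total of four counts depends only on the polygon, [x] and [z]. For the
     empty pair it is 8, which is 2 after averaging over four quadrants, and each new count is at
     least 2. *)
  by split; move: e1 e2 e3 e4 c1 c2 sx sz f1 f2 f3 f4; clear; lia.
by have [? ?] := g1 h1; have [? ?] := g3 h3; split; auto.
Qed.

End Plane.

(** * Lifting from the torus *)

Section Torus.
Variable P : grid_params.
Local Notation n := (gn P).
Local Notation p := (gp P).
Local Notation q := (gq P).
Local Notation N := (p * n)%N%:Z.
Local Notation pi := (@proj P).
Implicit Types (R S : rect) (r s : rectangle P) (x y z : {set torus P}).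

Lemma circ_pos : 0 < N. Proof. by rewrite ltz_nat circ_gt0. Qed.

Lemma plane_cover_proj : plane_cover N pi.
Proof.
have n0 : n%:Z != 0 by rewrite eqz_nat -lt0n gn_gt0.
have cpq : coprimez p q.
  rewrite /coprimez /gcdz /= eqz_nat.
  by case/orP: (gpqP P) => /andP[]; [|move=> /eqP-> /eqP->].
split=> [a b a' b' u v /proj_eq[k [m [e1 e2]]]|a b u|a b v].
- by apply/proj_eq; exists k, m; rewrite -e1 -e2; split; ring.
- split=> [/proj_eq[k [m [e1 e2]]]|/dvdzP[k ->]]; last first.
    by apply/proj_eq; exists (- k), 0; split; ring.
  have m0 : m = 0.
    by apply/eqP; move/esym/eqP: e2; rewrite subrr mulf_eq0 (negPf n0).
  by apply/dvdzP; exists (- k); move: e1; rewrite m0; clear; lia.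
- split=> [/proj_eq[k [m [e1 e2]]]|/dvdzP[k ->]]; last first.
    by apply/proj_eq; exists (q%:Z * k), (- (p%:Z * k)); rewrite !PoszM; split; ring.
  (* A lattice vector is vertical only if its coefficients satisfy [p k + q m = 0]; coprimality then
     makes [m] a multiple of [p], and the vector a multiple of [(0, pn)]. *)
  have : (p %| q%:Z * m)%Z.
    apply/dvdzP; exists (- k); apply: (mulfI n0).
    by move: e1; rewrite subrr !PoszM => e1; rewrite -[LHS]subr0 e1; ring.
  rewrite Gauss_dvdzr // => /dvdzP[c em]; apply/dvdzP; exists (- c).
  have -> : v = - (n%:Z * m) by rewrite -e2; ring.
  by rewrite em PoszM; ring.
Qed.

Lemma residue_small (m : nat) (m0 : (0 < m)%N) (i : 'I_m) : residue m0 i%:Z = i.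
Proof.
apply: val_inj; apply/eqP; rewrite -eqz_nat residueE modz_small //.
by rewrite lez_nat ltz_nat ltn_ord.
Qed.

Lemma proj_id (A : torus P) : pi A.1%:Z A.2%:Z = A.
Proof.
case: A => a b; rewrite /proj /= residue_small; congr pair.
rewrite divz_small ?mulr0 ?subr0 ?residue_small //.
by rewrite lez_nat ltz_nat ltn_ord.
Qed.

Lemma translate_proj a b u v : translate (pi a b) u v = pi (a + u%:Z) (b + v%:Z).
Proof. by apply: (cover_shift plane_cover_proj); rewrite proj_id. Qed.

Lemma row_proj a b : row_of (pi a b) = residue (gn_gt0 P) b.
Proof. by []. Qed.

(** Horizontal components of lattice vectors are multiples of [n], so the residue of the abscissa is
    well defined on [T]. *)
Lemma col_proj a b : col_of (pi a b) = residue (gn_gt0 P) a.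
Proof.
apply/residue_eq; rewrite residueE.
pose c := a - (q * n)%N%:Z * (b %/ n)%Z.
rewrite -/c; exists (q%:Z * (b %/ n)%Z + p%:Z * (c %/ N)%Z).
have ea : a = c + (q * n)%N%:Z * (b %/ n)%Z by rewrite subrK.
have ec := divz_eq c N.
rewrite [X in X - _]ea [X in X + _ - _]ec !PoszM; ring.
Qed.

Lemma generator_one_per_line x : is_generator x -> one_per_line pi x.
Proof.
case/andP=> /forallP hr /forallP hc; split=> a b c h1 h2.
  have /cards1P[A eA] := hr (row_of (pi a c)).
  have : pi a c \in [set A in x | row_of A == row_of (pi a c)] by rewrite inE h1 eqxx.
  have : pi b c \in [set A in x | row_of A == row_of (pi a c)] by rewrite inE h2 eqxx.
  by rewrite eA !inE => /eqP -> /eqP.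
have /cards1P[A eA] := hc (col_of (pi a b)).
have : pi a b \in [set A in x | col_of A == col_of (pi a b)] by rewrite inE h1 eqxx.
have : pi a c \in [set A in x | col_of A == col_of (pi a b)].
  by rewrite inE h2 !col_proj eqxx.
by rewrite eA !inE => /eqP -> /eqP.
Qed.

(** On every row and every column the corners removed and the corners added balance; summing
    [moves_eq] along the line shows that its number of points is unchanged. *)
Lemma moves_generator x y R : moves pi x y R -> is_generator x -> is_generator y.
Proof.
move=> m.
have line (f : torus P -> 'I_n) l :
    (f (ll pi R) == l)%:Z + (f (ur pi R) == l)%:Z =
    (f (lr pi R) == l)%:Z + (f (ul pi R) == l)%:Z ->
    #|[set A in y | f A == l]| = #|[set A in x | f A == l]|.
  move=> e; apply/eqP; rewrite -eqz_nat -subr_eq0 -oppr_eq0 opprB.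
  have card (u : {set torus P}) : #|[set A in u | f A == l]|%:Z =
      \sum_(A | f A == l) (A \in u)%:Z.
    rewrite -sum1_card (big_morph Posz PoszD (erefl _)) big_mkcond [RHS]big_mkcond.
    by apply: eq_bigr => A _; rewrite inE; case: (A \in u); case: eqP.
  rewrite !card -sumrB (eq_bigr _ (fun t _ => moves_eq m t)).
  have del (B : torus P) : \sum_(A | f A == l) (A == B)%:Z = (f B == l)%:Z.
    rewrite big_mkcond (bigD1 B) //= eqxx big1 ?addr0 => [|A /negPf nA].
      by case: (f B == l).
    by rewrite nA; case: ifP.
  rewrite /corners !(sumrB, big_split) /= !del e; apply/eqP; ring.
case/andP=> /forallP hr /forallP hc; apply/andP; split; apply/forallP => l.
  by rewrite line // !row_proj.
by rewrite line // !col_proj addrC.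
Qed.

Definition lifts r R :=
  [/\ llc r = ll pi R, (width r)%:Z = x1 R - x0 R & (height r)%:Z = y1 R - y0 R].

Definition lift r : rect :=
  MkRect (llc r).1%:Z (llc r).2%:Z ((llc r).1%:Z + (width r)%:Z)
    ((llc r).2%:Z + (height r)%:Z).

Lemma lifts_lift r : lifts r (lift r).
Proof. by rewrite /lifts /ll /= proj_id; split=> //; ring. Qed.

Lemma lifts_sim r R R' : lifts r R -> sim pi R R' -> lifts r R'.
Proof. by case=> a b c [d e f]; split; [rewrite a d | rewrite b | rewrite c]. Qed.

Lemma sim_lifts r R R' : lifts r R -> lifts r R' -> sim pi R R'.
Proof. by case=> a b c [d e f]; split; [rewrite -a | rewrite -b | rewrite -c]. Qed.

Lemma lifts_translate r R u v : lifts r R ->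
  translate (llc r) u v = pi (x0 R + u%:Z) (y0 R + v%:Z).
Proof. by case=> -> _ _; rewrite translate_proj. Qed.

Lemma lifts_corners r R : lifts r R ->
  [/\ llc r = ll pi R, lrc r = lr pi R, ulc r = ul pi R & urc r = ur pi R].
Proof.
move=> h; have [e ew eh] := h; rewrite /lrc /ulc /urc !(lifts_translate _ _ h).
have ex : x0 R + (width r)%:Z = x1 R by rewrite ew addrC subrK.
have ey : y0 R + (height r)%:Z = y1 R by rewrite eh addrC subrK.
by rewrite ex ey !addr0.
Qed.

Lemma small_lifts r R : lifts r R -> small N R.
Proof.
by case=> _ ew eh; rewrite /small -ew -eh !ltz_nat !ltn_ord.
Qed.

Lemma lifts_ex R : nonempty R -> small N R -> exists r, lifts r R.
Proof.
rewrite /nonempty /small => nR sR.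
have hw : (`|x1 R - x0 R| < p * n)%N by move: nR sR; clear; lia.
have hh : (`|y1 R - y0 R| < p * n)%N by move: nR sR; clear; lia.
exists (ll pi R, Ordinal hw, Ordinal hh); split=> //.
  by rewrite /width /=; move: nR; clear; lia.
by rewrite /height /=; move: nR; clear; lia.
Qed.

Lemma corner_neq R : nonempty R -> small N R ->
  [/\ ll pi R <> lr pi R, ll pi R <> ul pi R, ur pi R <> lr pi R & ur pi R <> ul pi R].
Proof.
rewrite /nonempty /small => nR sR.
have no (u : int) : 0 < u < N -> ~ (N %| u)%Z.
  have between (M c : int) : 0 < c * M < M -> c = 0 by clear; nia.
  by move=> hu /dvdzP[c e]; move: hu; rewrite e => /[dup] /between ->; rewrite mul0r.
have hx : 0 < x1 R - x0 R < N by move: nR sR; clear; lia.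
have hy : 0 < y1 R - y0 R < N by move: nR sR; clear; lia.
have ex b : pi (x1 R) b <> pi (x0 R) b.
  move=> e; apply: (no _ hx); apply/(cover_row plane_cover_proj (x0 R) b).
  by rewrite addrC subrK.
have ey a : pi a (y1 R) <> pi a (y0 R).
  move=> e; apply: (no _ hy); apply/(cover_col plane_cover_proj a (y0 R)).
  by rewrite addrC subrK.
by split; [exact: nesym (ex _) | exact: nesym (ey _) | exact: ey | exact: ex].
Qed.

(** Adjacent corners are distinct by [corner_neq] and opposite ones by assumption. With four
    distinct corners, the set-theoretic and the additive descriptions agree at each point. *)
Lemma connects_moves x y r R : lifts r R -> nonempty R ->
  connects x y r <-> moves pi x y R.
Proof.
move=> hr nR; have [e1 e2 e3 e4] := lifts_corners hr.
have [n1 n2 n3 n4] := corner_neq nR (small_lifts hr).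
rewrite /connects e1 e2 e3 e4; split.
  case/and5P=> _ _ /and3P[a b /eqP c] /and3P[d e /eqP f] /eqP g; split=> // t.
  have := congr1 (fun u : {set torus P} => t \in u) g; rewrite !inE /corners.
  have [->|m1] := eqVneq t (ll pi R).
    move/eqP/negPf: c => ->; move/eqP/negPf: n1 => ->; move/eqP/negPf: n2 => ->.
    by rewrite a /= => <-.
  have [->|m2] := eqVneq t (ur pi R).
    move/eqP/negPf: n3 => ->; move/eqP/negPf: n4 => ->.
    by rewrite b /= => <-.
  have [->|m3] := eqVneq t (lr pi R).
    by move/eqP/negPf: f => -> /= ->; rewrite d.
  have [->|m4] := eqVneq t (ul pi R); first by move=> /= ->; rewrite e.
  by move=> /= ->; ring.
case=> g a b c d e f.
case: hr => _ ew eh.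
have -> : (0 < width r)%N by rewrite -ltz_nat ew subr_gt0 (andP nR).1.
have -> : (0 < height r)%N by rewrite -ltz_nat eh subr_gt0 (andP nR).2.
rewrite a b d e /=; move/eqP: (c) => ->; move/eqP: (f) => -> /=.
apply/eqP/setP => t; have := g t; rewrite !inE /corners.
have [->|m1] := eqVneq t (ll pi R).
  move/eqP/negPf: c => ->; move/eqP/negPf: n1 => ->; move/eqP/negPf: n2 => ->.
  by rewrite a; case: (_ \in y).
have [->|m2] := eqVneq t (ur pi R).
  move/eqP/negPf: n3 => ->; move/eqP/negPf: n4 => ->.
  by rewrite b; case: (_ \in y).
have [->|m3] := eqVneq t (lr pi R).
  by move/eqP/negPf: f => ->; rewrite d; case: (_ \in x).
have [->|m4] := eqVneq t (ul pi R); first by rewrite e; case: (_ \in x).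
by case: (_ \in x); case: (_ \in y).
Qed.

Lemma interior_missesP x r R : lifts r R -> interior_misses r x <-> misses pi x R.
Proof.
move=> h; have [_ ew eh] := h; split=> [/forallP H i j hi hj|H].
  have hi' : (`|i - x0 R| < width r)%N by rewrite -ltz_nat ew; move: hi; clear; lia.
  have hj' : (`|j - y0 R| < height r)%N by rewrite -ltz_nat eh; move: hj; clear; lia.
  have /forallP/(_ (Ordinal hj'))/implyP := H (Ordinal hi').
  rewrite (lifts_translate _ _ h) /= => H'.
  have ei : i = x0 R + `|i - x0 R|%:Z by move: hi; clear; lia.
  have ej : j = y0 R + `|j - y0 R|%:Z by move: hj; clear; lia.
  by rewrite ei ej; apply: H'; move: hi hj; clear; lia.
apply/forallP => i; apply/forallP => j; apply/implyP => /andP[hi hj].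
rewrite (lifts_translate _ _ h); apply: H.
  by have := ltn_ord i; rewrite -ltz_nat ew; move: hi; clear; lia.
by have := ltn_ord j; rewrite -ltz_nat eh; move: hj; clear; lia.
Qed.
End Torus.

(** * Immersed polygons as regions of the plane modulo translations *)

Section Polygons.
Variable P : grid_params.
Local Notation n := (gn P).
Local Notation N := (gp P * n)%N%:Z.
Local Notation pi := (@proj P).
Implicit Types (R S : rect) (r s : rectangle P).

Lemma cell_lt r (c : cell r) : (c.1 < width r)%N /\ (c.2 < height r)%N.
Proof. by split; apply: ltn_ord. Qed.

Lemma cell_lift r R : lifts r R -> exists f : cell r -> cells R,
  bijective f /\ forall c, cx (f c) = x0 R + c.1%:Z /\ cy (f c) = y0 R + c.2%:Z.
Proof.
case=> _ ew eh.
have hw : width r = `|x1 R - x0 R|%N by rewrite -ew.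
have hh : height r = `|y1 R - y0 R|%N by rewrite -eh.
exists (fun c => (cast_ord hw c.1, cast_ord hh c.2)); split=> //.
exists (fun c : cells R => (cast_ord (esym hw) c.1, cast_ord (esym hh) c.2)).
  by move=> [i j]; rewrite /= !cast_ordK.
by move=> [i j]; rewrite /= !cast_ordKV.
Qed.

(** Translates the combinatorial gluing of [concat] into adjacency of planar unit squares modulo
    [M], separately for each choice of the rectangles containing the two cells. *)
Lemma concat_lift M r s R S : lifts r R -> lifts s S ->
  nonempty R -> nonempty S -> deck_group pi M -> develops pi M R S ->
  exists F : tile (concat r s) -> tiles R S, bijective F /\
    forall c d, [/\ tile_pos c = pi (tx (F c)) (ty (F c)),
      tile_right c d <-> M (tx (F d) - tx (F c) - 1) (ty (F d) - ty (F c)) &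
      tile_up c d <-> M (tx (F d) - tx (F c)) (ty (F d) - ty (F c) - 1)].
Proof.
move=> hr hs nR nS hM dv.
have [f [bf ef]] := cell_lift hr; have [g [bg eg]] := cell_lift hs.
have [c1 c2 c3 c4] := lifts_corners hr; have [d1 d2 d3 d4] := lifts_corners hs.
have [_ ew1 eh1] := hr; have [_ ew2 eh2] := hs.
have M00 a b : a = 0 -> b = 0 -> M a b by move=> -> ->; exact: (deck0 hM).
exists (fun c => match c with inl c => inl (f c) | inr c => inr (g c) end); split.
  case: bf bg => f' ff' f'f [g' gg' g'g].
  exists (fun c : tiles R S => match c with inl c => inl (f' c) | inr c => inr (g' c) end).
    by case=> c; rewrite ?ff' ?gg'.
  by case=> c; rewrite ?f'f ?g'g.
case=> c [] d /=; rewrite /cell_pos.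
- have [ex ey] := ef c; have [ex' ey'] := ef d.
  have [_ k1 k2] := dev_fst dv (in_cell (f c) nR) (in_cell (f d) nR).
  split; first by rewrite ex ey (lifts_translate _ _ hr).
  + split=> [/andP[/eqP h1 /eqP h2]|/k1]; last by rewrite ex ex' ey ey'; clear; lia.
    by apply: M00; rewrite ?ex ?ex' ?ey ?ey'; move: h1 h2; clear; lia.
  + split=> [/andP[/eqP h1 /eqP h2]|/k2]; last by rewrite ex ex' ey ey'; clear; lia.
    by apply: M00; rewrite ?ex ?ex' ?ey ?ey'; move: h1 h2; clear; lia.
- have [ex ey] := ef c; have [ex' ey'] := eg d.
  split; first by rewrite ex ey (lifts_translate _ _ hr).
  + apply: iff_trans (iff_sym (dev_right12 dv (in_cell (f c) nR) (in_cell (g d) nS))).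
    rewrite c2 d1 ex ex' ey ey';
    split=> [/and4P[/eqP h0 /eqP h1 /eqP h2 /eqP h3]|[h0 h1 h2 h3]].
      by split=> //; move: h1 h2 h3 ew1 ew2 eh1 eh2; clear; lia.
    by apply/and4P; split; [exact/eqP | move: h1 h2 h3 ew1 ew2 eh1 eh2; clear; lia..].
  + apply: iff_trans (iff_sym (dev_up12 dv (in_cell (f c) nR) (in_cell (g d) nS))).
    rewrite c3 d1 ex ex' ey ey';
    split=> [/and4P[/eqP h0 /eqP h1 /eqP h2 /eqP h3]|[h0 h1 h2 h3]].
      by split=> //; move: h1 h2 h3 ew1 ew2 eh1 eh2; clear; lia.
    by apply/and4P; split; [exact/eqP | move: h1 h2 h3 ew1 ew2 eh1 eh2; clear; lia..].
- have [ex ey] := eg c; have [ex' ey'] := ef d.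
  have [l1 l2] := cell_lt c; have [l3 l4] := cell_lt d.
  split; first by rewrite ex ey (lifts_translate _ _ hs).
  + apply: iff_trans (iff_sym (dev_right21 dv (in_cell (g c) nS) (in_cell (f d) nR))).
    rewrite c3 d4 ex ex' ey ey';
    split=> [/and4P[/eqP h0 /eqP h1 /eqP h2 /eqP h3]|[h0 h1 h2 h3]].
      by split=> //; move: h1 h2 h3 ew1 ew2 eh1 eh2 l1 l2 l3 l4; clear; lia.
    by apply/and4P; split; [exact/eqP |
      move: h1 h2 h3 ew1 ew2 eh1 eh2 l1 l2 l3 l4; clear; lia..].
  + apply: iff_trans (iff_sym (dev_up21 dv (in_cell (g c) nS) (in_cell (f d) nR))).
    rewrite c2 d4 ex ex' ey ey';
    split=> [/and4P[/eqP h0 /eqP h1 /eqP h2 /eqP h3]|[h0 h1 h2 h3]].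
      by split=> //; move: h1 h2 h3 ew1 ew2 eh1 eh2 l1 l2 l3 l4; clear; lia.
    by apply/and4P; split; [exact/eqP |
      move: h1 h2 h3 ew1 ew2 eh1 eh2 l1 l2 l3 l4; clear; lia..].
- have [ex ey] := eg c; have [ex' ey'] := eg d.
  have [_ k1 k2] := dev_snd dv (in_cell (g c) nS) (in_cell (g d) nS).
  split; first by rewrite ex ey (lifts_translate _ _ hs).
  + split=> [/andP[/eqP h1 /eqP h2]|/k1]; last by rewrite ex ex' ey ey'; clear; lia.
    by apply: M00; rewrite ?ex ?ex' ?ey ?ey'; move: h1 h2; clear; lia.
  + split=> [/andP[/eqP h1 /eqP h2]|/k2]; last by rewrite ex ex' ey ey'; clear; lia.
    by apply: M00; rewrite ?ex ?ex' ?ey ?ey'; move: h1 h2; clear; lia.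
Qed.

(** The bijection of tiles moves each tile by an element of [M], and positions in [T] and adjacency
    modulo [M] are both invariant under such moves. *)
Lemma same_dev_polygon M r s r' s' R S R' S' :
  lifts r R -> lifts s S -> lifts r' R' -> lifts s' S' ->
  same_dev pi M R S R' S' -> same_polygon (concat r s) (concat r' s').
Proof.
move=> hr hs hr' hs' sd; have hM := sd_deck sd; have [nR nS nR' nS'] := sd_ne sd.
have [F [bF eF]] := concat_lift hr hs nR nS hM (sd_dev1 sd).
have [F' [[G' FG GF] eF']] := concat_lift hr' hs' nR' nS' hM (sd_dev2 sd).
have [T [bT eT]] := tile_bij sd.
exists (G' \o T \o F); split.
- by do 2?[apply: bij_comp => //]; exists F'.
- move=> c; have [-> _ _] := eF' (G' (T (F c))) (G' (T (F c))).
  have [-> _ _] := eF c c; rewrite GF.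
  rewrite -[RHS](deck_cover hM _ _ (eT (F c))); congr proj; ring.
- move=> c d; have [_ h _] := eF c d.
  have [_ h' _] := eF' (G' (T (F c))) (G' (T (F d))); rewrite !GF in h'.
  apply/idP/idP => [/h' m|/h m]; [apply/h | apply/h'].
    have := deckD hM (deckD hM m (eT (F c))) (deckN hM (eT (F d))).
    by congr M; clear; lia.
  have := deckD hM (deckD hM m (eT (F d))) (deckN hM (eT (F c))).
  by congr M; clear; lia.
- move=> c d; have [_ _ h] := eF c d.
  have [_ _ h'] := eF' (G' (T (F c))) (G' (T (F d))); rewrite !GF in h'.
  apply/idP/idP => [/h' m|/h m]; [apply/h | apply/h'].
    have := deckD hM (deckD hM m (eT (F c))) (deckN hM (eT (F d))).
    by congr M; clear; lia.
  have := deckD hM (deckD hM m (eT (F d))) (deckN hM (eT (F c))).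
  by congr M; clear; lia.
Qed.
End Polygons.

(** * Annuli contain an X marking *)

Section Partner.
Variable P : grid_params.
Local Notation n := (gn P).
Local Notation p := (gp P).
Local Notation q := (gq P).
Local Notation N := (gp P * n)%N%:Z.
Local Notation pi := (@proj P).
Implicit Types (R S : rect) (r s : rectangle P).

Lemma row_meets (A : torus P) a b : row_of A = residue (gn_gt0 P) b ->
  exists i, a <= i < a + N /\ A = pi i b.
Proof.
rewrite -{1}[A]proj_id row_proj => /residue_eq[m em].
set i0 := A.1%:Z + (q * n)%N%:Z * m.
have N0 := circ_pos P.
have eA : A = pi i0 b.
  by rewrite -{1}[A]proj_id; apply/proj_eq; exists 0, m; rewrite -em /i0; split; ring.
exists (a + ((i0 - a) %% N)%Z); split.
  have := modz_ge0 (i0 - a) (lt0r_neq0 N0); have := ltz_pmod (i0 - a) N0.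
  by move: (modz _ _) => c; clear; lia.
rewrite eA; apply/esym; apply/proj_eq; exists ((i0 - a) %/ N)%Z, 0.
by have e := divz_eq (i0 - a) N; split; last ring; move: e; clear; lia.
Qed.

Lemma col_meets (A : torus P) a b : col_of A = residue (gn_gt0 P) a ->
  exists j, b <= j < b + N /\ A = pi a j.
Proof.
rewrite -{1}[A]proj_id col_proj => /residue_eq[m em].
have cpq : gcdz p q = 1.
  apply/eqP; rewrite /gcdz /= eqz_nat.
  by case/orP: (gpqP P) => /andP[]; [|move=> /eqP-> /eqP->].
(* A lattice vector with horizontal component [n m] is needed to reach the prescribed vertical line;
   the Bezout coefficients of [p] and [q] provide it. *)
have [u [v euv]] := Bezoutz p q; rewrite cpq in euv.
set j0 := A.2%:Z + n%:Z * (v * m).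
have N0 := circ_pos P.
have eA : A = pi a j0.
  rewrite -{1}[A]proj_id; apply/proj_eq; exists (u * m), (v * m).
  rewrite em /j0; split; last by ring.
  by rewrite -[m in LHS]mul1r -euv !PoszM; ring.
exists (b + ((j0 - b) %% N)%Z); split.
  have := modz_ge0 (j0 - b) (lt0r_neq0 N0); have := ltz_pmod (j0 - b) N0.
  by move: (modz _ _) => c; clear; lia.
rewrite eA; apply/eqP; rewrite eq_sym; apply/eqP.
have e := divz_eq (j0 - b) N.
rewrite -[RHS](_ : pi a (b + ((j0 - b) %% N)%Z + ((j0 - b) %/ N)%Z * N) = _).
  by apply/esym; apply/(cover_col (plane_cover_proj P)); apply: dvdz_mull.
by congr proj; move: e; clear; lia.
Qed.

Lemma cell_pos_ex r R i j : lifts r R -> in_rect R i j ->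
  exists c : cell r, cell_pos c = pi i j.
Proof.
move=> h; have [_ ew eh] := h; rewrite /in_rect => hij.
have hi : (`|i - x0 R| < width r)%N by rewrite -ltz_nat ew; move: hij; clear; lia.
have hj : (`|j - y0 R| < height r)%N by rewrite -ltz_nat eh; move: hij; clear; lia.
exists (Ordinal hi, Ordinal hj); rewrite /cell_pos (lifts_translate _ _ h) /=.
by congr proj; move: hij; clear; lia.
Qed.

Definition unmarked (G : grid_diagram P) r :=
  forall (c : cell r) i, cell_pos c != markX G i.

(** The bottom rows of unit squares of [R] and [S] together run once around [T], so they contain the
    X of that row. *)
Lemma row_not_covered (G : grid_diagram P) r s R S :
  lifts r R -> lifts s S -> nonempty R -> nonempty S -> unmarked G r -> unmarked G s ->
  x0 S = x1 R -> y0 S = y0 R -> x1 S - x0 R = N -> False.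
Proof.
rewrite /nonempty => hr hs nR nS ur us ex ey eN.
have [k [hk _]] := markX_row G (residue (gn_gt0 P) (y0 R)).
have [i [hi ei]] := row_meets (x0 R) hk.
have [lt|ge] := ltrP i (x1 R).
  have [|c ec] := @cell_pos_ex r R i (y0 R) hr.
    by move: hi lt nR; rewrite /in_rect; clear; lia.
  by have := ur c k; rewrite ec ei eqxx.
have [|c ec] := @cell_pos_ex s S i (y0 R) hs.
  by move: hi ge nS ex ey eN; rewrite /in_rect; clear; lia.
by have := us c k; rewrite ec ei eqxx.
Qed.

Lemma col_not_covered (G : grid_diagram P) r s R S :
  lifts r R -> lifts s S -> nonempty R -> nonempty S -> unmarked G r -> unmarked G s ->
  y0 S = y1 R -> x0 S = x0 R -> y1 S - y0 R = N -> False.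
Proof.
rewrite /nonempty => hr hs nR nS ur us ey ex eN.
have [k [hk _]] := markX_col G (residue (gn_gt0 P) (x0 R)).
have [j [hj ej]] := col_meets (y0 R) hk.
have [lt|ge] := ltrP j (y1 R).
  have [|c ec] := @cell_pos_ex r R (x0 R) j hr.
    by move: hj lt nR; rewrite /in_rect; clear; lia.
  by have := ur c k; rewrite ec ej eqxx.
have [|c ec] := @cell_pos_ex s S (x0 R) j hs.
  by move: hj ge nS ex ey eN; rewrite /in_rect; clear; lia.
by have := us c k; rewrite ec ej eqxx.
Qed.

(** If the edges glued at a common corner have equal length, their other ends put two points of [y]
    on one line, so these coincide and [N] divides the joint extent of the rectangles. That extent
    is less than [2 N], hence equal to [N], and a whole row or column is covered. *)
Lemma no_annulus (G : grid_diagram P) (y : {set torus P}) r s R S :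
  lifts r R -> lifts s S -> nonempty R -> nonempty S -> unmarked G r -> unmarked G s ->
  one_per_line pi y -> lr pi R \in y -> ul pi R \in y -> ll pi S \in y -> ur pi S \in y ->
  [/\ lr pi R = ll pi S -> y1 R - y0 R <> y1 S - y0 S,
      ul pi R = ur pi S -> y1 R - y0 R <> y1 S - y0 S,
      ul pi R = ll pi S -> x1 R - x0 R <> x1 S - x0 S &
      lr pi R = ur pi S -> x1 R - x0 R <> x1 S - x0 S].
Proof.
move=> hr hs nR nS mr ms [lrow lcol] lrR ulR llS urS.
have sR := small_lifts hr; have sS := small_lifts hs.
have hp := plane_cover_proj P.
have twice (u : int) : 0 < u < N + N -> (N %| u)%Z -> u = N.
  have between (M c : int) : 0 < c * M < M + M -> c = 1 by clear; nia.
  by move=> hu /dvdzP[c e]; move: hu; rewrite e => /between ->; rewrite mul1r.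
have colN a b c : pi a b = pi a c -> (N %| c - b)%Z.
  move=> e; apply/(cover_col hp a b); by rewrite addrC subrK.
have rowN a b c : pi a b = pi c b -> (N %| c - a)%Z.
  move=> e; apply/(cover_row hp a b); by rewrite addrC subrK.
split=> e eh.
- pose S' := MkRect (x1 R) (y0 R) (x1 R + (x1 S - x0 S)) (y0 R + (y1 S - y0 S)).
  have s' : sim pi S S' by split; [rewrite -e | rewrite /=; clear; ring..].
  have nS' : nonempty S' by move: nS; rewrite /nonempty /=; clear; lia.
  have [_ _ _ eur] := sim_corners hp s'; rewrite eur in urS.
  have ey : y1 S' = y1 R by rewrite /= -eh; clear; ring.
  rewrite /ur ey in urS; have /rowN d := lrow _ _ _ ulR urS.
  apply: (row_not_covered hr (lifts_sim hs s') nR nS' mr ms) => //.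
  by apply: twice d; move: nR nS' sR sS; rewrite /nonempty /small /=; clear; lia.
- pose S' := MkRect (x0 R - (x1 S - x0 S)) (y0 R) (x0 R) (y1 R).
  have s' : sim pi S S'.
    split; [|rewrite /=; clear; ring| by rewrite /= eh].
    have := cover_shift hp (x0 S - x1 S) (y0 S - y1 S) e; rewrite /ll /=.
    by rewrite ![_ S + (_ - _)]addrC !subrK => <-; congr proj; move: eh; clear; lia.
  have nS' : nonempty S' by move: nR nS; rewrite /nonempty /=; clear; lia.
  have [ell _ _ _] := sim_corners hp s'; rewrite ell in llS.
  have /rowN d := lrow _ _ _ llS lrR.
  apply: (row_not_covered (lifts_sim hs s') hr nS' nR ms mr) => //.
  by apply: twice d; move: nR nS' sR sS; rewrite /nonempty /small /=; clear; lia.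
- pose S' := MkRect (x0 R) (y1 R) (x0 R + (x1 S - x0 S)) (y1 R + (y1 S - y0 S)).
  have s' : sim pi S S' by split; [rewrite -e | rewrite /=; clear; ring..].
  have nS' : nonempty S' by move: nS; rewrite /nonempty /=; clear; lia.
  have [_ _ _ eur] := sim_corners hp s'; rewrite eur in urS.
  have ey : x1 S' = x1 R by rewrite /= -eh; clear; ring.
  rewrite /ur ey in urS; have /colN d := lcol _ _ _ lrR urS.
  apply: (col_not_covered hr (lifts_sim hs s') nR nS' mr ms) => //.
  by apply: twice d; move: nR nS' sR sS; rewrite /nonempty /small /=; clear; lia.
- pose S' := MkRect (x0 R) (y0 R - (y1 S - y0 S)) (x1 R) (y0 R).
  have s' : sim pi S S'.
    split; [|by rewrite /= eh|rewrite /=; clear; ring].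
    have := cover_shift hp (x0 S - x1 S) (y0 S - y1 S) e; rewrite /ll /=.
    by rewrite ![_ S + (_ - _)]addrC !subrK => <-; congr proj; move: eh; clear; lia.
  have nS' : nonempty S' by move: nR nS; rewrite /nonempty /=; clear; lia.
  have [ell _ _ _] := sim_corners hp s'; rewrite ell in llS.
  have /colN d := lcol _ _ _ llS ulR.
  apply: (col_not_covered (lifts_sim hs s') hr nS' nR ms mr) => //.
  by apply: twice d; move: nR nS' sR sS; rewrite /nonempty /small /=; clear; lia.
Qed.
End Partner.

(** * Existence of a partner *)

Section Redecomposition.
Variable P : grid_params.
Local Notation N := (gp P * gn P)%N%:Z.
Local Notation pi := (@proj P).
Implicit Types (R S : rect) (r s : Rect P).

Lemma lifts_inj (a b : rectangle P) R : lifts a R -> lifts b R -> a = b.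
Proof.
case: a b => [[a w] h] [[a' w'] h']; rewrite /lifts /llc /width /height /=.
case=> -> e1 e2 [-> e3 e4]; congr (_, _, _); apply: val_inj; apply/eqP.
  by rewrite -eqz_nat e1 e3.
by rewrite -eqz_nat e2 e4.
Qed.

Lemma same_polygon_swap (a b : rectangle P) :
  lrc a <> llc b -> ulc a <> urc b -> ulc a <> llc b -> lrc a <> urc b ->
  lrc b <> llc a -> ulc b <> urc a -> ulc b <> llc a -> lrc b <> urc a ->
  same_polygon (concat a b) (concat b a).
Proof.
do 8![move=> /eqP/negPf ?].
exists (fun c : cell a + cell b => match c with inl c => inr c | inr c => inl c end).
split.
- exists (fun c : cell b + cell a => match c with inl c => inr c | inr c => inl c end);
    by case.
- by case.
- by case=> c [] d //=; apply/idP/idP => /and4P[]; congruence.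
- by case=> c [] d //=; apply/idP/idP => /and4P[]; congruence.
Qed.

Definition empty_pair r1 r2 := empty_rect r1 && empty_rect r2.

(** Carries planar data back to [Rect]: the bounds give rectangles of the torus, and the
    intermediate set is a generator because a move preserves generators. *)
Lemma partner_of_lifts r1 r2 (w : {set torus P}) R' S' :
  nonempty R' -> nonempty S' -> small N R' -> small N S' ->
  moves pi (val (src r1)) w R' -> moves pi w (val (tgt r2)) S' ->
  misses pi (val (src r1)) R' -> misses pi w R' ->
  misses pi w S' -> misses pi (val (tgt r2)) S' ->
  (forall s1 s2 : rectangle P, lifts s1 R' -> lifts s2 S' ->
    same_polygon (concat (shape r1) (shape r2)) (concat s1 s2)) ->
  ~ (lifts (shape r1) R' /\ lifts (shape r2) S') ->
  exists r3 r4, [/\ composable r3 r4, same_concat r1 r2 r3 r4,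
    (r1, r2) <> (r3, r4) & empty_pair r3 r4].
Proof.
move=> nR nS sR sS mR mS h1 h2 h3 h4 hp ne.
have [s1 l1] := lifts_ex nR sR; have [s2 l2] := lifts_ex nS sS.
have gw : is_generator w := moves_generator mR (valP (src r1)).
pose W : generator P := exist _ w gw.
have c1 : connects (val (src r1)) (val W) s1 by apply/(connects_moves _ _ l1 nR).
have c2 : connects (val W) (val (tgt r2)) s2 by apply/(connects_moves _ _ l2 nS).
exists (exist _ ((src r1, W), s1) c1), (exist _ ((W, tgt r2), s2) c2); split=> //.
- by split=> //; apply: hp.
- by move=> [e1 e2]; apply: ne; rewrite e1 e2.
- apply/andP; split; apply/andP; split; apply/interior_missesP; eassumption.
Qed.

Lemma nonempty_lift r : nonempty (lift (shape r)).
Proof.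
by have /and5P[w h _ _ _] := valP r; rewrite /nonempty /= !ltrDl !ltz_nat; apply/andP.
Qed.

Lemma moves_lift r : moves pi (val (src r)) (val (tgt r)) (lift (shape r)).
Proof.
by apply/(connects_moves _ _ (lifts_lift _) (nonempty_lift r)); exact: (valP r).
Qed.

Lemma partner_ex (G : grid_diagram P) r1 r2 : composable r1 r2 ->
  empty_pair r1 r2 -> avoidsX G r1 -> avoidsX G r2 ->
  exists r3 r4, [/\ composable r3 r4, same_concat r1 r2 r3 r4,
    (r1, r2) <> (r3, r4) & empty_pair r3 r4].
Proof.
move=> cmp /andP[/andP[e1 e2] /andP[e3 e4]] a1 a2.
set R := lift (shape r1); set S := lift (shape r2).
set x := val (src r1); set y := val (tgt r1); set z := val (tgt r2).
have yE : val (src r2) = y by rewrite /y cmp.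
have lR : lifts (shape r1) R by apply: lifts_lift.
have lS : lifts (shape r2) S by apply: lifts_lift.
have nR : nonempty R by apply: nonempty_lift.
have nS : nonempty S by apply: nonempty_lift.
have mR : moves pi x y R by apply: moves_lift.
have mS : moves pi y z S by rewrite -yE; apply: moves_lift.
have gen (g : generator P) := generator_one_per_line (valP g).
have hp := plane_cover_proj P.
have tm : two_moves N pi x y z R S by split=> //; apply: gen.
have um1 : unmarked G (shape r1).
  by move=> c i; have /forallP/(_ c)/forallP := a1.
have um2 : unmarked G (shape r2).
  by move=> c i; have /forallP/(_ c)/forallP := a2.
(* With annuli excluded, the edges glued at any common corner have different lengths, so a reflex
   corner is available for recutting. *)
have [n1 n2 n3 n4] := no_annulus lR lS nR nS um1 um2 (gen (tgt r1))
  (moves_lr mR) (moves_ul mR) (moves_ll mS) (moves_ur mS).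
rewrite yE in e3.
have glued : redecomposable pi x z R S -> exists r3 r4, [/\ composable r3 r4,
    same_concat r1 r2 r3 r4, (r1, r2) <> (r3, r4) & empty_pair r3 r4].
  case=> R' [S' [nR' nS' ns [w mw1 mw2] [Rl [Sl [M [[s1 s2] hM d1 d2 [c1 c2]]]]]]].
  have lRl := lifts_sim lR s1; have lSl := lifts_sim lS s2.
  have nRl : nonempty Rl by case: s1 => _; move: nR; rewrite /nonempty; clear; lia.
  have nSl : nonempty Sl by case: s2 => _; move: nS; rewrite /nonempty; clear; lia.
  have sd : same_dev pi M Rl Sl R' S' by [].
  have tml : two_moves N pi x y z Rl Sl.
    split=> //; try exact: gen; first exact: moves_sim hp s1 mR.
    exact: moves_sim hp s2 mS.
  (* The recut rectangles are small and empty because both pairs have the same quadrant counts. *)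
  have [sR' sS' [q1 q2] [q3 q4]] : [/\ small N R', small N S',
      misses pi x R' /\ misses pi w R' & misses pi w S' /\ misses pi z S'].
    apply: (same_count_misses (circ_pos P) tml _ _ _ _ _ _ mw1 mw2 nR' nS'
      (fun u => same_dev_count u sd));
      by [exact: small_lifts lRl | exact: small_lifts lSl |
          apply/interior_missesP; eassumption].
  apply: (@partner_of_lifts r1 r2 w R' S') => //.
    by move=> t1 t2 l1 l2; apply: same_dev_polygon lRl lSl l1 l2 sd.
  by move=> [l1 l2]; apply: ns; split; [exact: sim_lifts lR l1 | exact: sim_lifts lS l2].
have [e|f1] := eqVneq (lr pi R) (ll pi S).
  by apply: glued; apply: redecomposable_lrll tm e (n1 e).
have [e|f2] := eqVneq (ul pi R) (ur pi S).
  by apply: glued; apply: redecomposable_ulur tm e (n2 e).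
have [e|f3] := eqVneq (ul pi R) (ll pi S).
  by apply: glued; apply: redecomposable_ulll tm e (n3 e).
have [e|f4] := eqVneq (lr pi R) (ur pi S).
  by apply: glued; apply: redecomposable_lrur tm e (n4 e).
(* No corner is shared: the corners of [S] in [y] already lie in [x], and those of [R] in [y]
   survive in [z]. So [S] can be applied first, and in either order the polygon is the formal
   union. *)
have [m1 m2 m3 m4] := corner_neq nR (small_lifts lR).
have llRy : ll pi R \notin y.
  by apply/negP => h; apply: m1; apply: (proj1 (gen (tgt r1))) h (moves_lr mR).
have urRy : ur pi R \notin y.
  by apply/negP => h; apply: m4; apply: (proj1 (gen (tgt r1))) h (moves_ul mR).
have in_src t : t \in y -> t != lr pi R -> t != ul pi R -> t \in x.
  move=> ty /negPf g1 /negPf g2; have := moves_eq mR t; rewrite /corners ty g1 g2.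
  by case: (t \in x) => //; case: (t == _); case: (t == _).
have in_tgt t : t \in y -> t != ll pi S -> t != ur pi S -> t \in z.
  move=> ty /negPf g1 /negPf g2; have := moves_eq mS t; rewrite /corners ty g1 g2.
  by case: (t \in z) => //; case: (t == _); case: (t == _).
have llSx : ll pi S \in x by apply: in_src; rewrite ?(moves_ll mS) // eq_sym.
have urSx : ur pi S \in x by apply: in_src; rewrite ?(moves_ur mS) // eq_sym.
have lrRz : lr pi R \in z by apply: in_tgt; rewrite ?(moves_lr mR).
have ulRz : ul pi R \in z by apply: in_tgt; rewrite ?(moves_ul mR).
have [mw1 lrSx ulSx] := moves_moved hp (gen (src r1)) llSx urSx (moves_src mS).
set w := moved pi x S in mw1.
have in_w t : t \in x -> t \notin y -> t \in w.
  move=> tx ty; rewrite !inE tx andbT; apply/orP; left; apply/negP.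
  by case/orP=> /eqP e; move: ty; rewrite e ?(moves_ll mS) ?(moves_ur mS).
have mw2 : moves pi w z R.
  split=> //; first last.
  - exact: moves_tgt mR.
  - exact: moves_src mR.
  - by apply: in_w urRy; apply: moves_ur mR.
  - by apply: in_w llRy; apply: moves_ll mR.
  move=> t; have -> : (t \in w)%:Z - (t \in z)%:Z =
      ((t \in y)%:Z - (t \in z)%:Z) + ((t \in x)%:Z - (t \in y)%:Z)
      - ((t \in x)%:Z - (t \in w)%:Z) by ring.
  by rewrite (moves_eq mw1) (moves_eq mR) (moves_eq mS); ring.
have [_ _ [q1 q2] [q3 q4]] : [/\ small N S, small N R,
    misses pi x S /\ misses pi w S & misses pi w R /\ misses pi z R].
  apply: (same_count_misses (circ_pos P) tm _ _ _ _ _ _ mw1 mw2) => //;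
    try by [exact: small_lifts lR | exact: small_lifts lS |
            apply/interior_missesP; eassumption].
  by move=> u; rewrite addrC.
have nein (g : {set torus P}) u v : u \in g -> v \notin g -> v <> u.
  by move=> gu gv e; move: gv; rewrite e gu.
apply: (@partner_of_lifts r1 r2 w S R) => //.
- exact: small_lifts lS.
- exact: small_lifts lR.
- move=> s1 s2 l1 l2.
  rewrite -(lifts_inj lS l1) -(lifts_inj lR l2).
  have [b1 b2 b3 b4] := lifts_corners lR; have [d1 d2 d3 d4] := lifts_corners lS.
  apply: same_polygon_swap; rewrite ?b1 ?b2 ?b3 ?b4 ?d1 ?d2 ?d3 ?d4.
  all: try by [apply/eqP | exact: nein (moves_ll mR) lrSx | exact: nein (moves_ur mR) ulSx
    | exact: nein (moves_ll mR) ulSx | exact: nein (moves_ur mR) lrSx].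
(* The swapped pair is different, since the lower left corner of [S] lies in [y] and that of [R]
   does not. *)
- move=> [l1 _]; have [ell _ _ _] := lifts_corners l1.
  have [ell' _ _ _] := lifts_corners lR.
  by move: llRy; rewrite -ell' ell (moves_ll mS).
Qed.
End Redecomposition.

(** * The square of the differential *)

Section Square.
Variable P : grid_params.
Local Notation n := (gn P).
Implicit Types (r s : Rect P).

Lemma same_polygon_sym A B : same_polygon A B -> same_polygon (P := P) B A.
Proof.
case=> f [[g fg gf] hp hr hu]; exists g; split; first by exists f.
- by move=> c; rewrite -hp gf.
- by move=> c d; rewrite -hr !gf.
- by move=> c d; rewrite -hu !gf.
Qed.

Lemma same_polygon_trans A B C :
  same_polygon A B -> same_polygon B C -> same_polygon (P := P) A C.
Proof.
case=> f [bf hp hr hu] [g [bg hp' hr' hu']]; exists (g \o f); split.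
- exact: bij_comp.
- by move=> c; rewrite /= hp' hp.
- by move=> c d; rewrite /= hr' hr.
- by move=> c d; rewrite /= hu' hu.
Qed.

Lemma same_concat_trans r1 r2 r3 r4 r5 r6 : same_concat r1 r2 r3 r4 ->
  same_concat r3 r4 r5 r6 -> same_concat r1 r2 r5 r6.
Proof.
by case=> a b h [c d h']; split; rewrite ?a ?b //; exact: same_polygon_trans h h'.
Qed.

Lemma avoidsX_concat (G : grid_diagram P) r1 r2 r3 r4 : same_concat r1 r2 r3 r4 ->
  avoidsX G r1 -> avoidsX G r2 -> avoidsX G r3 && avoidsX G r4.
Proof.
case=> _ _ /same_polygon_sym[f [_ hp _ _]] /forallP a1 /forallP a2.
have a (c : tile (concat (shape r1) (shape r2))) i : tile_pos c != markX G i.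
  by case: c => c; [have /forallP := a1 c | have /forallP := a2 c].
apply/andP; split; apply/forallP => c; apply/forallP => i.
  by have := hp (inl c); rewrite /= => <-; apply: a.
by have := hp (inr c); rewrite /= => <-; apply: a.
Qed.

Lemma countO_concat (G : grid_diagram P) r1 r2 r3 r4 i : same_concat r1 r2 r3 r4 ->
  (countO G r1 i + countO G r2 i = countO G r3 i + countO G r4 i)%N.
Proof.
case=> _ _ [f [bf hp _ _]].
have E (a b : rectangle P) : (#|[set c : cell a | cell_pos c == markO G i]| +
    #|[set c : cell b | cell_pos c == markO G i]| =
    \sum_(c : tile (concat a b) | tile_pos c == markO G i) 1)%N.
  rewrite [RHS]big_sumType /= !sum1dep_card //.
rewrite /countO !E [RHS](reindex f) /=; last exact: onW_bij.
by apply: eq_bigl => c; have /= -> := hp c.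
Qed.

Variables (G : grid_diagram P) (S : Rect P -> int).
Hypothesis hS : sign_assignment S.

Definition counted (x z : generator P) (u : Rect P * Rect P) : bool :=
  [&& src u.1 == x, tgt u.1 == src u.2, tgt u.2 == z, empty_pair u.1 u.2,
      avoidsX G u.1 & avoidsX G u.2].

Definition pair_sign (u : Rect P * Rect P) : int := S u.1 * S u.2.

Lemma pair_sign_values u : pair_sign u = 1 \/ pair_sign u = -1.
Proof.
rewrite /pair_sign; case: (sign_values hS u.1) => ->;
  case: (sign_values hS u.2) => ->; by [left | right].
Qed.

(* A partner of the partner of u has the same sign as u, so by [sign_square] it
   cannot differ from u. *)
Lemma partner_fun x z : exists f : Rect P * Rect P -> Rect P * Rect P,
  forall u, counted x z u -> [/\ counted x z (f u), f (f u) = u,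
    pair_sign (f u) = - pair_sign u &
    same_concat u.1 u.2 (f u).1 (f u).2].
Proof.
have ex u : exists v, counted x z u -> [/\ counted x z v, u <> v,
    pair_sign v = - pair_sign u & same_concat u.1 u.2 v.1 v.2].
  case: (boolP (counted x z u)) => [|_]; last by exists u.
  case/and5P=> /eqP e1 /eqP e2 /eqP e3 e4 /andP[e5 e6].
  have [r3 [r4 [h1 h2 h3 h4]]] := partner_ex e2 e4 e5 e6.
  exists (r3, r4) => _; split=> //.
  - have /andP[b5 b6] := avoidsX_concat h2 e5 e6.
    case: (h2) => g1 g2 _; apply/and5P; split=> //=; last by apply/andP.
    + by rewrite -g1 e1.
    + exact/eqP.
    + by rewrite -g2 e3.
  - by rewrite [u]surjective_pairing.
  - rewrite /pair_sign -[LHS]opprK; congr (- _); apply/esym.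
    exact: (sign_square hS e2 h1 h2 h3).
have [f hf] := choice ex; exists f => u cu.
have [c1 n1 s1 p1] := hf u cu; have [c2 n2 s2 p2] := hf _ c1.
split=> //; apply/eqP; case: eqP => // ne; exfalso.
have [d1 d2] : composable u.1 u.2 /\ composable (f (f u)).1 (f (f u)).2.
  by case/and5P: cu => _ /eqP ? _ _ _; case/and5P: c2 => _ /eqP ? _ _ _.
have sc := same_concat_trans p1 p2.
have : pair_sign u = - pair_sign (f (f u)).
  apply: (sign_square hS d1 d2 sc); rewrite -!surjective_pairing.
  by move=> e; apply: ne; rewrite -e.
rewrite s2 s1 opprK; case: (pair_sign_values u) => ->; clear; lia.
Qed.
End Square.

(** * Cancellation of the coefficients *)

Section Differential.
Variables (P : grid_params) (G : grid_diagram P) (S : Rect P -> int).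
Variables (A : comNzRingType) (V : 'I_(gn P) -> A).
Hypothesis hS : sign_assignment S.

Definition weight (r : Rect P) : A :=
  (S r)%:~R * \prod_(i < gn P) V i ^+ countO G r i.

Lemma sum_counted (x z : generator P) :
  \sum_(u | counted G x z u) weight u.1 * weight u.2 = 0.
Proof.
have [f hf] := partner_fun G hS x z.
have wf u : counted G x z u ->
    weight (f u).1 * weight (f u).2 = - (weight u.1 * weight u.2).
  move=> /hf[_ _ s p]; rewrite /weight.
  have E (r1 r2 : Rect P) : (S r1)%:~R * (\prod_(i < gn P) V i ^+ countO G r1 i) *
     ((S r2)%:~R * (\prod_(i < gn P) V i ^+ countO G r2 i)) =
     (pair_sign S (r1, r2))%:~R * \prod_(i < gn P) V i ^+ (countO G r1 i + countO G r2 i).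
    rewrite mulrACA -intrM -big_split; congr (_ * _).
    by apply: eq_bigr => i _; rewrite exprD.
  rewrite !E -!surjective_pairing s mulrNz mulNr; congr (- (_ * _)).
  by apply: eq_bigr => i _; rewrite (countO_concat G i p).
(* In a general ring a sum equal to its own negative need not vanish. The pairs are therefore split
   by sign; [f] exchanges the two halves, which cancel term by term. *)
rewrite (bigID (fun u => pair_sign S u == 1)) /=.
rewrite [X in _ + X](reindex_onto f f) /=; last by move=> u /andP[/hf[]].
rewrite [X in _ + X](eq_bigl (fun u => counted G x z u && (pair_sign S u == 1))).
  rewrite -big_split big1 // => u /andP[cu _] /=.
  by rewrite wf // subrr.
move=> u; apply/idP/idP => [/andP[/andP[c1 ns] /eqP e]|/andP[cu /eqP s]].
  have [c2 _ s _] := hf _ c1; rewrite e in c2 s; rewrite c2 s /=.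
  by case: (pair_sign_values hS (f u)) ns => ->.
by have [-> -> -> _] := hf _ cu; rewrite s eqxx.
Qed.

Lemma diff_gen_coef (x z : generator P) : diff_gen V G S x z =
  \sum_(r : Rect P | [&& src r == x, tgt r == z, empty_rect r & avoidsX G r]) weight r.
Proof.
have -> : diff_gen V G S x z = \sum_y \sum_(r : Rect P | [&& src r == x, tgt r == y,
    empty_rect r & avoidsX G r]) weight r * (z == y)%:R.
  rewrite /diff_gen sum_ffunE; apply: eq_bigr => y _.
  by rewrite sum_ffunE; apply: eq_bigr => r _; rewrite !ffunE.
rewrite (big_only1 z) // => [|y yz _].
  by apply: eq_bigr => r _; rewrite eqxx mulr1.
by rewrite big1 // => r _; rewrite eq_sym (negPf yz) mulr0.
Qed.

(** Holding over any commutative ring with chosen elements [V], this covers the polynomial ring and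
    its quotient by [V_1] at once. *)
Lemma differential_square (c : chain P A) :
  differential V G S (differential V G S c) = 0.
Proof.
apply/ffunP => z; rewrite [RHS]ffunE /differential sum_ffunE.
transitivity (\sum_y \sum_x c x * (diff_gen V G S x y * diff_gen V G S y z)).
  apply: eq_bigr => y _; rewrite ffunE sum_ffunE scaler_suml.
  by apply: eq_bigr => x _; rewrite ffunE; apply: esym; apply: mulrA.
rewrite exchange_big big1 //= => x _; rewrite -mulr_sumr.
(* The coefficient of [z] in the square at [x] is the sum over counted pairs, grouped by the
   intermediate generator [y]. *)
rewrite [X in _ * X](_ : _ = 0) ?mulr0 // -[RHS](sum_counted x z).
transitivity (\sum_y \sum_(u : Rect P * Rect P | counted G x z u && (tgt u.1 == y))
    weight u.1 * weight u.2); last first.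
  by rewrite [RHS](partition_big (fun u => tgt u.1) xpredT).
apply: eq_bigr => y _; rewrite !diff_gen_coef big_distrlr pair_big /=.
apply: eq_bigl => u; rewrite /counted /empty_pair.
have [->|ne] := eqVneq (tgt u.1) y; last by rewrite !andbF.
rewrite [src u.2 == y]eq_sym /= andbT.
by do 3![case: (_ == _)]; case: (empty_rect u.1); case: (empty_rect u.2);
  case: (avoidsX _ u.1); case: (avoidsX _ u.2).
Qed.
End Differential.

Unset Implicit Arguments.

Theorem mainTheorem3 (P : grid_params) (G : grid_diagram P)
    (S : Rect P -> int) :
  represents_knot G -> sign_assignment S ->
  (forall c : GCminus P, diff_minus G S (diff_minus G S c) = 0) /\
  (forall c : GChat P, diff_hat G S (diff_hat G S c) = 0).
Proof. by move=> _ hS; split=> c; apply: differential_square. Qed.
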